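(* Let $k\ge1$, let $u_h$ be the $k$-th order continuous Galerkin finite element solution, and for each $\tau\in\mathcal{T}_h$ let $\widetilde u_{\tau,h}\in V_h^k(\tau)$ be the post-processed solution. Put $\widetilde{\boldsymbol{\nu}}_h=-\kappa\nabla\widetilde u_{\tau,h}$ on each $\tau$. Then for every $\xi\in Z_{\mathrm{in}}$ the local conservation property is satisfied on the control volume $C^\xi$: $$\int_{\partial C^\xi}\widetilde{\boldsymbol{\nu}}_h\cdot\boldsymbol{n}\,dl=\int_{C^\xi}f\,d\boldsymbol{x},$$ where $\boldsymbol{n}$ is the unit normal outward to $C^\xi$.
   Context: Setting. $\Omega\subset\mathbb{R}^2$ is a bounded open polygonal domain with Lipschitz boundary, $f\in L^2(\Omega)$, $0<\kappa_{\min}\le\kappa(\boldsymbol{x})\le\kappa_{\max}<\infty$ for all $\boldsymbol{x}\in\Omega$, and $g$ is the Dirichlet boundary data. The model problem is $-\nabla\cdot(\kappa\nabla u)=f$ in $\Omega$, $u=g$ on $\partial\Omega$. $\mathcal{T}_h$ is a partition of $\overline\Omega$ into triangular elements $\tau$. $P^k(\tau)$ is the space of polynomials of degree at most $k$ on $\tau$. Finite element solution. $V_h^k=\{w\in C(\overline\Omega): w|_\tau\in P^k(\tau)\ \forall\tau\in\mathcal{T}_h,\ w|_{\partial\Omega}=0\}$. Let $a(v,w)=\int_\Omega\kappa\nabla v\cdot\nabla w\,d\boldsymbol{x}$, $\ell(w)=\int_\Omega f w\,d\boldsymbol{x}$, and let $a_\tau,\ell_\tau$ be the same integrals over $\tau$.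 The solution $u_h$ is the continuous, piecewise $P^k$ function with $u_h-g_h\in V_h^k$ and $a(u_h,w)=\ell(w)$ for all $w\in V_h^k$, where $g_h$ is the continuous piecewise $P^k$ interpolant of $g$ in the usual finite element basis. Dual mesh. On each $\tau$, $s(\tau,k)$ is the set of the $N_k=\frac12(k+1)(k+2)$ degrees of freedom (Lagrange nodes of degree $k$). $Z_{\mathrm{in}}$ is the set of all interior degrees of freedom of the mesh, i.e. those not lying on $\partial\Omega$. Divide $\tau$ equally into $k^2$ sub-triangles with vertices in $s(\tau,k)$, and in each sub-triangle connect the barycenter to the midpoints of the three edges, cutting it into three quadrilaterals, one for each of its vertices. For $\xi\in s(\tau,k)$, $t_\xi\subset\tau$ is the union of the quadrilaterals containing $\xi$. The control volume $C^\xi$ is the union of the polygons $t_\xi$ over all $\tau$ having $\xi$ as a node. One decomposes $\partial t_\xi=(\partial\tau\cap\partial t_\xi)\cup(\partial C^\xi\cap\partial t_\xi)$, where $\partial C^\xi\cap\partial t_\xi$ denotes the part of $\partial t_\xi$ interior to $\tau$. On $\partial t_\xi$, $\boldsymbol{n}$ is the unit normal outward to $t_\xi$; on $\partial\tau$ it is outward to $\tau$. Post-processing. $V_h^k(\tau)=\mathrm{span}\{\phi_\xi\}_{\xi\in s(\tau,k)}=P^k(\tau)$, where $\phi_\xi$ is the usual nodal basis function at $\xi$ restricted to $\tau$. $I_\tau w=\sum_{\xi\in s(\tau,k)}w(\xi)\psi_\xi$, where $\psi_\xi$ is the characteristic function of $t_\xi$. On an edge, or part of an edge, which is the intersection of two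 elements $\tau_1,\tau_2$, the average is $\{\boldsymbol{v}\}=\frac12(\boldsymbol{v}|_{\tau_1}+\boldsymbol{v}|_{\tau_2})$ (the source defines the average only on such edges). Define $$b_\tau(v,w)=-\sum_{\xi\in s(\tau,k)}\int_{\partial C^\xi\cap\partial t_\xi}\kappa\nabla v\cdot\boldsymbol{n}\,I_\tau w\,dl,\qquad e_\tau(v,w)=\int_{\partial\tau}\{\kappa\nabla v\}\cdot\boldsymbol{n}\,w\,dl,$$ where in the $\xi$-th term $I_\tau w$ takes its value $w(\xi)$ on $t_\xi$. The post-processed solution $\widetilde u_{\tau,h}\in V_h^k(\tau)$ is a solution (determined up to an additive constant) of $$b_\tau(\widetilde u_{\tau,h},w)=\ell_\tau(I_\tau w-w)+a_\tau(u_h,w)+e_\tau(u_h,I_\tau w-w)\quad\forall w\in V_h^k(\tau).$$ *)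

(* Defs.v *)
From HB Require Import structures.
From mathcomp Require Import all_boot all_order all_algebra.
From mathcomp Require Import all_classical all_reals all_analysis.
Import Order.TTheory GRing.Theory Num.Theory.
Import numFieldNormedType.Exports.

Set Implicit Arguments.
Unset Strict Implicit.
Unset Printing Implicit Defensive.

Local Open Scope classical_set_scope.
Local Open Scope ring_scope.

Section Plane.
Context {R : realType}.
Notation pt := (R * R)%type.

Definition leb2 := (@lebesgue_measure R \x @lebesgue_measure R)%E.

Definition dot (p q : pt) : R := p.1 * q.1 + p.2 * q.2.

Definition rot90 (p : pt) : pt := (- p.2, p.1).

Definition grad (v : pt -> R) (x : pt) : pt :=
  ('D_((1, 0) : pt) v x, 'D_((0, 1) : pt) v x).

Definition frontier (A : set pt) : set pt := closure A `\` interior A.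

Definition hull (I : finType) (P : I -> pt) : set pt :=
  [set x | exists2 c : I -> R,
     (forall i, 0 <= c i) /\ \sum_i c i = 1 & x = \sum_i c i *: P i].

Definition segment (p q : pt) : set pt :=
  [set x | exists2 t : R, 0 <= t <= 1 & x = (1 - t) *: p + t *: q].

(* Meaningful where A coincides near x with a closed half-plane through x,
   e.g. on the boundary of a closed polygon away from its corners; there the
   vector is unique. *)
Definition onormal (A : set pt) (x : pt) : pt :=
  xget (0 : pt) [set n : pt | dot n n = 1 /\
    \forall y \near x, A y <-> dot (y - x) n <= 0].

(* Each line of the plane has exactly one arc-length parametrization
   t |-> l.1 + t *: l.2 with l in this set. *)
Definition lines : set (pt * pt) :=
  [set l | [/\ dot l.2 l.2 = 1, dot l.1 l.2 = 0 &
               0 < l.2.1 \/ l.2 = ((0, 1) : pt)]].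

(* Line integral of h with respect to arc length over a set B contained in a
   finite union of segments: only finitely many lines meet B in a set of
   positive length, and distinct lines meet in at most one point, so the
   finitely supported sum over all lines is the integral of h against the
   one-dimensional measure of B. *)
Definition lint (B : set pt) (h : pt -> R) : R :=
  \sum_(l \in lines)
    \int[@lebesgue_measure R]_(t in [set t : R | B (l.1 + t *: l.2)])
      h (l.1 + t *: l.2).

Definition lipschitz_boundary (Om : set pt) : Prop :=
  forall x, frontier Om x ->
    exists (e : pt) (gamma : R -> R) (r L : R),
      [/\ dot e e = 1, 0 < r,
          (forall s t, `|gamma s - gamma t| <= L * `|s - t|) &
          (forall s t, `|s| < r -> `|t| < r ->
             (Om (x + s *: e + t *: rot90 e) <-> t < gamma s))].

Definition polygonal_boundary (Om : set pt) : Prop :=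
  exists E : seq (pt * pt),
    frontier Om = \bigcup_(e in [set` E]) segment e.1 e.2.

Definition polygonal_lipschitz_domain (Om : set pt) : Prop :=
  [/\ Om !=set0 /\ open Om, connected Om, bounded_set Om,
      polygonal_boundary Om & lipschitz_boundary Om].

Definition L2 (Om : set pt) (f : pt -> R) : Prop :=
  (f \_ Om) \in Lfun leb2 2%:E.

(* A triangle is given by its vertices; the closed element is their hull. *)
Definition nondegenerate (V : 'I_3 -> pt) : Prop :=
  dot (rot90 (V (inord 1) - V ord0)) (V (inord 2) - V ord0) != 0.

(* Conforming triangulation: two distinct elements are disjoint, or share
   exactly a common vertex, or exactly a common edge. *)
Definition triangulation (Om : set pt) (J : finType)
    (V : J -> 'I_3 -> pt) : Prop :=
  [/\ closure Om = \bigcup_j hull (V j),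
      (forall j, nondegenerate (V j)) &
      (forall j j', j != j' ->
        [\/ hull (V j) `&` hull (V j') = set0,
            (exists i i', V j i = V j' i' /\
               hull (V j) `&` hull (V j') = [set V j i]) |
            (exists i1 i2 i1' i2',
               [/\ i1 != i2, V j i1 = V j' i1', V j i2 = V j' i2' &
                   hull (V j) `&` hull (V j') =
                     segment (V j i1) (V j i2)])])].

Definition Pk (k : nat) (p : pt -> R) : Prop :=
  exists c : nat -> nat -> R, forall x,
    p x = \sum_(i < k.+1) \sum_(j < k.+1 | (i + j <= k)%N)
            c i j * x.1 ^+ i * x.2 ^+ j.

Definition lattice_pt (k : nat) (V : 'I_3 -> pt) (a : 'I_3 -> nat) : pt :=
  \sum_i ((a i)%:R / k%:R) *: V i.

Definition nodes (k : nat) (V : 'I_3 -> pt) : set pt :=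
  [set lattice_pt k V a | a in [set a | (\sum_i a i = k)%N]].

(* The k ^ 2 congruent sub-triangles: k(k+1)/2 translates of V / k and
   k(k-1)/2 translates of - V / k. *)
Definition subtriangles (k : nat) (V : 'I_3 -> pt) : set ('I_3 -> pt) :=
  [set (fun i => lattice_pt k V (fun j => a j + (j == i))%N)
     | a in [set a | (\sum_i a i + 1 = k)%N]] `|`
  [set (fun i => lattice_pt k V (fun j => a j + (j != i))%N)
     | a in [set a | (\sum_i a i + 2 = k)%N]].

Definition midpoint (p q : pt) : pt := 2^-1 *: (p + q).

Definition barycenter (S : 'I_3 -> pt) : pt := 3^-1 *: \sum_i S i.

(* Corners: the barycenter and the midpoints of S i and S j, the midpoint for
   j = i being the vertex S i itself. *)
Definition quad (S : 'I_3 -> pt) (i : 'I_3) : set pt :=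
  hull (fun o : option 'I_3 =>
    if o is Some j then midpoint (S i) (S j) else barycenter S).

(* t_xi; a node lies in the quadrilateral quad S i only as its vertex S i. *)
Definition tcell (k : nat) (V : 'I_3 -> pt) (xi : pt) : set pt :=
  [set x | exists S i, [/\ subtriangles k V S, quad S i xi & quad S i x]].

(* The part of the boundary of t_xi interior to the element. *)
Definition dual_edge (k : nat) (V : 'I_3 -> pt) (xi : pt) : set pt :=
  frontier (tcell k V xi) `&` interior (hull V).

Definition Itau (k : nat) (V : 'I_3 -> pt) (w : pt -> R) (x : pt) : R :=
  \sum_(xi \in nodes k V) w xi * \1_(tcell k V xi) x.

(* The polynomial restriction to the closed element of a piecewise polynomial
   function; its gradient on the edges is the one-sided trace. *)
Definition restr (k : nat) (V : 'I_3 -> pt) (v : pt -> R) : pt -> R :=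
  xget (cst 0) [set p | Pk k p /\ forall x, hull V x -> v x = p x].

(* For piecewise polynomials the pointwise gradient exists off the edges of the
   mesh, a null set. *)
Definition aform (kappa : pt -> R) (D : set pt) (v w : pt -> R) : R :=
  \int[leb2]_(x in D) (kappa x * dot (grad v x) (grad w x)).

Definition lform (f : pt -> R) (D : set pt) (w : pt -> R) : R :=
  \int[leb2]_(x in D) (f x * w x).

Definition btau (k : nat) (kappa : pt -> R) (V : 'I_3 -> pt)
    (v w : pt -> R) : R :=
  - \sum_(xi \in nodes k V)
      lint (dual_edge k V xi) (fun x =>
        dot (kappa x *: grad v x) (onormal (tcell k V xi) x) * w xi).

Section Mesh.
Context (k : nat) (Om : set pt) (J : finType) (V : J -> 'I_3 -> pt).

(* {kappa grad v} on the boundary of the element j.  A point of an edge other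
   than a vertex lies in at most one other element.  On the edges lying in the
   boundary of Om there is no average, and the flux is a parameter gb. *)
Definition avg_flux (kappa : pt -> R) (gb : pt -> pt) (v : pt -> R)
    (j : J) (x : pt) : pt :=
  if [pick j' | (j' != j) && (x \in hull (V j'))] is Some j' then
    2^-1 *: (kappa x *: grad (restr k (V j) v) x +
             kappa x *: grad (restr k (V j') v) x)
  else gb x.

Definition etau (kappa : pt -> R) (gb : pt -> pt) (v : pt -> R) (j : J)
    (w : pt -> R) : R :=
  lint (frontier (hull (V j))) (fun x =>
    dot (avg_flux kappa gb v j x) (onormal (hull (V j)) x) * w x).

(* Continuous piecewise P^k functions; values outside closure Om are
   irrelevant. *)
Definition fe_fun (w : pt -> R) : Prop :=
  {within closure Om, continuous w} /\
  forall j, exists2 p, Pk k p & forall x, hull (V j) x -> w x = p x.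

Definition Vh (w : pt -> R) : Prop :=
  fe_fun w /\ forall x, frontier Om x -> w x = 0.

Definition dofs : set pt := \bigcup_j nodes k (V j).

Definition Zin : set pt := dofs `\` frontier Om.

(* Only the boundary values of gh matter, so its values at the interior
   degrees of freedom are left free. *)
Definition interpolant (g gh : pt -> R) : Prop :=
  fe_fun gh /\ forall xi, dofs xi -> frontier Om xi -> gh xi = g xi.

Definition fe_solution (kappa f gh uh : pt -> R) : Prop :=
  [/\ fe_fun uh, Vh (fun x => uh x - gh x) &
      forall w, Vh w -> aform kappa Om uh w = lform f Om w].

Definition post_processed (kappa f : pt -> R) (gb : pt -> pt)
    (uh : pt -> R) (j : J) (ut : pt -> R) : Prop :=
  Pk k ut /\
  forall w, Pk k w ->
    let d := fun x => Itau k (V j) w x - w x in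
    btau k kappa (V j) ut w =
      lform f (hull (V j)) d + aform kappa (hull (V j)) uh w
      + etau kappa gb uh j d.

Definition control_volume (xi : pt) : set pt :=
  \bigcup_(j in [set j | nodes k (V j) xi]) tcell k (V j) xi.

(* The elementwise flux - kappa grad (ut j) on the element j; the choice of
   the element only matters on the edges of the mesh. *)
Definition flux (kappa : pt -> R) (ut : J -> pt -> R) (x : pt) : pt :=
  if [pick j | x \in hull (V j)] is Some j then - (kappa x *: grad (ut j) x)
  else 0.

End Mesh.
End Plane.

(* Main.v *)
(* Test the elementwise equation with the nodal basis function of xi on every
   element having xi as a node, and sum.  The left-hand sides add up to the flux
   of the post-processed solution through the dual edges, which make up the
   boundary of the control volume C.  On the right, the edge terms cancel in
   pairs: the averaged flux and the defect [Itau phi - phi] are single-valued on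
   an edge through xi, the normals are opposite, and the defect vanishes on the
   other edges; no edge through xi lies on the boundary since xi is interior.
   The volume terms containing phi cancel by the finite element equation, so the
   integral of f over C remains.
     A dual cell is an element intersected with a hexagon in barycentric
   coordinates.  Off finitely many points, every polygon met here is locally a
   half-plane at its boundary, so all line integrals reduce to integrals along
   a common finite set of lines. *)

(* Two obstacles shape the proof. Of [f] and [kappa] nothing is known off [Om], while the elements
   are closed and may reach its boundary; every integrand is therefore replaced by one that is cut
   off inside [Om] and agrees with it off a null set, and this replacement must not presuppose
   measurability. Moreover [lint] is a sum over lines, so additivity requires its integrands to be
   integrable along each of them: the representatives are taken in a class [nice] of bounded
   measurable functions with bounded support, which restrict well to lines. The Lipschitz boundary
   enters through the inclusion of the interior of [closure Om] in [Om]. It rules out slits, where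
   an edge could have elements on both sides and still belong to the boundary. The hexagon of a node
   is the set where all differences of its scaled barycentric displacements are at most one. This
   condition is invariant under permutations of the coordinates, which is how the traces from two
   elements are compared. *)
Require Import Defs.
From HB Require Import structures.
From mathcomp Require Import all_boot all_order all_algebra all_fingroup.
From mathcomp Require Import all_classical all_reals all_analysis.
From mathcomp Require Import measurable_realfun ring lra.
Import Order.TTheory GRing.Theory Num.Theory.
Import numFieldNormedType.Exports.
Set Implicit Arguments.
Unset Strict Implicit.
Unset Printing Implicit Defensive.
Local Open Scope classical_set_scope.
Local Open Scope ring_scope.

(** * Integrals and null sets *)

Section NullModification.
Import HBNNSimple.
Context d (T : measurableType d) (R : realType).
Variable mu : {measure set T -> \bar R}.

(* No measurability of [f]: coefficients and data are unconstrained on the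
   boundary of the domain, which meets the closed elements in a null set. *)
Lemma nnintegral_sup_le (N : set T) (f g : T -> \bar R) :
  measurable N -> mu N = 0%E -> (forall x, 0 <= g x)%E ->
  (forall x, ~ N x -> f x = g x) ->
  (ereal_sup [set sintegral mu h |
      h in [set h : {nnsfun T >-> R} | forall x, ((h x)%:E <= f x)%E]] <=
   ereal_sup [set sintegral mu h |
      h in [set h : {nnsfun T >-> R} | forall x, ((h x)%:E <= g x)%E]])%E.
Proof.
move=> mN N0 g0 fg; apply: ge_ereal_sup => _ /= [h hf <-].
have mNC : measurable (~` N) by exact: measurableC.
have hE x : proj_nnsfun h mNC x = if x \in ~` N then h x else 0.
  by rewrite -mrestrict.
apply: ereal_sup_ubound; exists (proj_nnsfun h mNC).
  move=> x; rewrite hE; case: ifPn => xN.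
    by rewrite -fg//; move: xN; rewrite inE.
  exact: g0.
rewrite -!integralT_nnsfun; apply: ge0_ae_eq_integral => //.
- by apply/measurable_EFinP.
- by apply/measurable_EFinP; exact: measurable_funPT.
- by move=> x _; rewrite lee_fin.
- by move=> x _; rewrite lee_fin.
- exists N; split => // x; apply: contra_notP => Nx _.
  by congr EFin; rewrite hE mem_set.
Qed.

Lemma integral_null_modification (N : set T) (f g : T -> \bar R) :
  measurable N -> mu N = 0%E -> (forall x, ~ N x -> f x = g x) ->
  (\int[mu]_x f x = \int[mu]_x g x)%E.
Proof.
move=> mN N0 fg; rewrite /integral !patch_setT.
congr (_ - _)%E; apply/eqP; rewrite eq_le; apply/andP; split;
  by apply: (nnintegral_sup_le mN) => // x Nx; rewrite ?funeposE ?funenegE ?fg.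
Qed.

(** The domain is absorbed into the integrand, so integrals over different sets become comparable as
    integrals over the whole space. *)
Lemma Rintegral_null_modification (N D : set T) (f g : T -> R) :
  measurable N -> mu N = 0%E -> (forall x, ~ N x -> (f \_ D) x = g x) ->
  \int[mu]_(x in D) f x = \int[mu]_x g x.
Proof.
move=> mN N0 fg; rewrite Rintegral_mkcond /Rintegral; congr fine.
by apply: integral_null_modification mN N0 _ => x /fg ->.
Qed.

(** Both conclusions are proved at once: additivity at each step of the induction needs
    integrability of the remaining sum. *)
Lemma Rintegral_sum (I : Type) (r : seq I) (P : pred I) (F : I -> T -> R) :
  (forall i, P i -> mu.-integrable setT (EFin \o F i)) ->
  mu.-integrable setT (EFin \o (fun x => \sum_(i <- r | P i) F i x)) /\
  \int[mu]_x (\sum_(i <- r | P i) F i x) =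
  \sum_(i <- r | P i) \int[mu]_x F i x.
Proof.
move=> iF; elim: r => [|i r [IH1 IH2]].
  rewrite big_nil; split.
    apply: (eq_integrable _ (cst 0%E)) => //; last exact: integrable0.
    by move=> x _ /=; rewrite big_nil.
  under eq_Rintegral do rewrite big_nil.
  by rewrite Rintegral_cst// mul0r.
rewrite big_cons; case: ifPn => Pi; split.
- apply: (eq_integrable _ (EFin \o (fun x => F i x + \sum_(j <- r | P j) F j x))) => //.
    by move=> x _ /=; rewrite big_cons Pi.
  by have := integrableD measurableT (iF i Pi) IH1; exact: eq_integrable.
- under eq_Rintegral do rewrite big_cons Pi.
  by rewrite RintegralD ?IH2//; exact: iF.
- by apply: eq_integrable IH1 => // x _ /=; rewrite big_cons (negPf Pi).
- under eq_Rintegral do rewrite big_cons (negPf Pi).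
  exact: IH2.
Qed.

Lemma RintegralN (f : T -> R) :
  mu.-integrable setT (EFin \o f) ->
  \int[mu]_x (- f x) = - \int[mu]_x f x.
Proof.
move=> mf; under eq_Rintegral do rewrite -mulN1r.
by rewrite RintegralZl// mulN1r.
Qed.

End NullModification.

(** * Affine functions and half-planes *)

Section AffineFunctions.
Context {R : realType}.
Notation pt := (R * R)%type.
Implicit Types (x y v w : pt) (a b : pt -> R).

Lemma scaleRE (t r : R) : t *: r = t * r.
Proof. by []. Qed.

Lemma ptP x y : x.1 = y.1 -> x.2 = y.2 -> x = y.
Proof. by case: x y => [x1 x2] [y1 y2] /= -> ->. Qed.

Lemma sum_fst (I : Type) (r : seq I) (P : pred I) (F : I -> pt) :
  (\sum_(i <- r | P i) F i).1 = \sum_(i <- r | P i) (F i).1.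
Proof. exact: (raddf_sum (@fst R R)). Qed.

Lemma sum_snd (I : Type) (r : seq I) (P : pred I) (F : I -> pt) :
  (\sum_(i <- r | P i) F i).2 = \sum_(i <- r | P i) (F i).2.
Proof. exact: (raddf_sum (@snd R R)). Qed.

Lemma dot_gt0 v : v != 0 -> 0 < dot v v.
Proof.
move=> v0; rewrite /dot -!expr2 lt0r addr_ge0 ?sqr_ge0// andbT.
rewrite paddr_eq0 ?sqr_ge0// !sqrf_eq0.
by apply: contra v0 => /andP[/eqP h1 /eqP h2]; apply/eqP/ptP.
Qed.

(** The gradient, read off from three values. Being defined for every function, it makes [affine] a
    plain equation without existential quantifier. *)
Definition alin a : pt := (a (1, 0) - a 0, a (0, 1) - a 0).

Definition affine a := forall x, a x = dot (alin a) x + a 0.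

Lemma affineP a (p : pt) (c : R) : (forall x, a x = dot p x + c) ->
  affine a /\ alin a = p.
Proof.
move=> h; have e : alin a = p.
  by apply: ptP; rewrite /alin /= !h /dot /=; ring.
split=> // x; rewrite e !h /dot /=; ring.
Qed.

Lemma affine_cst (c : R) : affine (fun=> c).
Proof. by apply: (affineP (p := 0) (c := c) _).1 => x; rewrite /dot/=; ring. Qed.

Lemma affineD a b : affine a -> affine b -> affine (fun x => a x + b x).
Proof. by move=> ha hb x; rewrite /= ha hb /dot /alin /=; ring. Qed.

Lemma affineZ (c : R) a : affine a -> affine (fun x => c * a x).
Proof. by move=> ha x; rewrite /= ha /dot /alin /=; ring. Qed.

Lemma affineB a b : affine a -> affine b -> affine (fun x => a x - b x).
Proof. by move=> ha hb x; rewrite /= ha hb /dot /alin /=; ring. Qed.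

Lemma affine_ray a x v (t : R) : affine a ->
  a (x + t *: v) = a x + t * dot (alin a) v.
Proof. move=> ha; rewrite ha (ha x) /dot /= !scaleRE; ring. Qed.

Lemma affine_sub a x y : affine a -> a y - a x = dot (alin a) (y - x).
Proof. by move=> ha; rewrite ha (ha x) /dot /=; ring. Qed.

Lemma affine_comb (I : finType) a (c : I -> R) (P : I -> pt) : affine a ->
  \sum_i c i = 1 -> a (\sum_i c i *: P i) = \sum_i c i * a (P i).
Proof.
move=> ha c1; rewrite ha -[a 0]mul1r -c1 mulr_suml.
rewrite /dot sum_fst sum_snd !mulr_sumr -!big_split /=.
by apply: eq_bigr => i _; rewrite (ha (P i)) /dot /= !scaleRE; ring.
Qed.

Lemma fst_continuous2 : continuous (fst : pt -> R).
Proof. by move=> x; exact: cvg_fst. Qed.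

Lemma snd_continuous2 : continuous (snd : pt -> R).
Proof. by move=> x; exact: cvg_snd. Qed.

Lemma affine_continuous a : affine a -> continuous a.
Proof.
move=> ha; rewrite (_ : a = fun x => (alin a).1 * x.1 + (alin a).2 * x.2 + a 0).
  move=> x; apply: cvgD; last exact: cvg_cst.
  by apply: cvgD; apply: cvgMl_tmp; [exact: fst_continuous2|exact: snd_continuous2].
by apply/funext => x; rewrite ha /dot.
Qed.

Lemma near_gt0 a x : continuous a -> 0 < a x -> \forall y \near x, 0 < a y.
Proof. by move=> ca ax; apply: (@cvgr_gt _ _ (nbhs x) _ a (a x)) => //; exact: ca. Qed.

Lemma near_ray (P : set pt) x v : (\forall y \near x, P y) ->
  exists2 e : R, 0 < e & forall t : R, `|t| <= e -> P (x + t *: v).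
Proof.
move=> nP; have ct : (x + t *: v) @[t --> (0 : R)] --> x + (0 : R) *: v.
  by apply: cvgD; [exact: cvg_cst|apply: cvgZr_tmp; exact: cvg_id].
rewrite scale0r addr0 in ct.
have : \forall t \near (0 : R), P (x + t *: v) by exact: ct.
move=> /nbhs_ballP[e /= e0 h]; exists (e / 2); first by rewrite divr_gt0.
move=> t te; apply: h; rewrite /ball /= sub0r normrN.
by apply: le_lt_trans te _; rewrite ltr_pdivrMr// ltr_pMr// ltr1n.
Qed.

Lemma near_pos_side a x : affine a -> alin a != 0 -> a x = 0 ->
  forall P : set pt, (\forall y \near x, P y) -> exists2 y, P y & 0 < a y.
Proof.
move=> ha a0 ax P /(near_ray (alin a))[e e0 h].
exists (x + e *: alin a); first by apply: h; rewrite gtr0_norm.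
by rewrite affine_ray// ax add0r mulr_gt0// dot_gt0.
Qed.

Lemma near_neg_side a x : affine a -> alin a != 0 -> a x = 0 ->
  forall P : set pt, (\forall y \near x, P y) -> exists2 y, P y & a y < 0.
Proof.
move=> ha a0 ax P /(near_ray (alin a))[e e0 h].
exists (x + (- e) *: alin a); first by apply: h; rewrite normrN gtr0_norm.
by rewrite affine_ray// ax add0r mulNr oppr_lt0 mulr_gt0// dot_gt0.
Qed.

Definition vlen v : R := Num.sqrt (dot v v).

Lemma dotZr v w (c : R) : dot v (c *: w) = c * dot v w.
Proof. by rewrite /dot /= !scaleRE; ring. Qed.

Lemma dotC v w : dot v w = dot w v.
Proof. by rewrite /dot /=; ring. Qed.

Lemma dotNr v w : dot v (- w) = - dot v w.
Proof. by rewrite /dot /=; ring. Qed.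

(** The tangent directions of one half-plane are tangent to the other, so [n'] is a multiple of [n];
    unit length and the common side leave the factor 1. *)
Lemma halfplane_normal_unique (n n' : pt) x :
  dot n n = 1 -> dot n' n' = 1 ->
  (\forall y \near x, dot (y - x) n <= 0 <-> dot (y - x) n' <= 0) -> n = n'.
Proof.
move=> n1 n'1 nn.
(* A half-plane is a cone: what holds for short vectors holds for all. *)
have key w : dot w n <= 0 -> dot w n' <= 0.
  have [e e0 /(_ e)] := near_ray w nn; rewrite gtr0_norm// => /(_ (lexx _)).
  rewrite addrC addKr !(dotC (e *: w)) !dotZr !(dotC _ w) !pmulr_rle0//.
  by case.
have /key h1 : dot (rot90 n) n <= 0 by rewrite /dot /rot90 /=; lra.
have /key h2 : dot (- rot90 n) n <= 0 by rewrite /dot /rot90 /=; lra.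
have h3 : dot (rot90 n) n' = 0.
  by move: h1 h2; rewrite /dot /rot90 /=; lra.
have /key h4 : dot (- n) n <= 0 by rewrite dotC dotNr n1; lra.
case: n n' n1 n'1 h3 h4 {nn key h1 h2} => [a b] [c d].
rewrite /dot /rot90 /= => n1 n'1 h3 h4.
(* [s] is the inner product of [n] and [n'], and [n'] will be [s] times [n]. *)
set s := a * c + b * d; have s0 : 0 <= s by rewrite /s; lra.
have ec : c = s * a.
  transitivity (c * (a * a + b * b) + b * (- b * c + a * d) * 0); first by rewrite n1; ring.
  have -> : c * (a * a + b * b) = s * a - b * (- b * c + a * d) by rewrite /s; ring.
  by rewrite h3; ring.
have ed : d = s * b.
  transitivity (d * (a * a + b * b)); first by rewrite n1; ring.
  have -> : d * (a * a + b * b) = s * b + a * (- b * c + a * d) by rewrite /s; ring.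
  by rewrite h3; ring.
have ss : s * s = 1 by rewrite -n'1 ec ed -[LHS]mulr1 -n1; ring.
have s1 : s = 1.
  by apply/eqP; rewrite -(@eqrXn2 _ 2) ?ler01 ?expr1n ?expr2 ?ss//.
by rewrite ec ed s1 !mul1r.
Qed.

(** The normalized negative gradient meets the condition in [onormal], so the default of [xget] is
    not taken, and uniqueness identifies the chosen vector. *)
Lemma onormal_halfplane (A : set pt) a x : affine a -> alin a != 0 -> a x = 0 ->
  (\forall y \near x, A y <-> 0 <= a y) ->
  onormal A x = - ((vlen (alin a))^-1 *: alin a).
Proof.
move=> ha a0 ax nA; set n := - _.
have l0 : 0 < vlen (alin a) by rewrite sqrtr_gt0 dot_gt0.
have n1 : dot n n = 1.
  rewrite /n dotNr dotC dotNr opprK dotZr dotC dotZr.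
  have : vlen (alin a) ^+ 2 = dot (alin a) (alin a) by rewrite sqr_sqrtr// ltW// dot_gt0.
  by move=> <-; field; rewrite gt_eqF.
have hn y : (dot (y - x) n <= 0) = (0 <= a y).
  rewrite /n dotNr dotZr oppr_le0 pmulr_rge0 ?invr_gt0// dotC -affine_sub//.
  by rewrite ax subr0.
rewrite /onormal; case: xgetP => [m _ [m1 mA]|/(_ n)]; last first.
  by move=> /= []; split=> //; apply: filterS nA => y; rewrite hn.
apply: (@halfplane_normal_unique _ _ x) => //.
apply: filterS2 mA nA => y [mA1 mA2] [nA1 nA2]; rewrite hn.
by split => [/mA2/nA1|/nA2/mA1].
Qed.

Lemma onormal_near (A B : set pt) x : (\forall y \near x, A y <-> B y) ->
  onormal A x = onormal B x.
Proof.
move=> AB; rewrite /onormal; congr xget; apply/seteqP; split => n [n1 nA];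
  by split=> //; apply: filterS2 AB nA => y [h1 h2] [h3 h4]; split; tauto.
Qed.

Lemma frontier_near (A B : set pt) x : (\forall y \near x, A y <-> B y) ->
  frontier A x -> frontier B x.
Proof.
move=> AB [cA iA]; split => [N Nx|iB].
  have [y [Ay [Ny ABy]]] := cA _ (filterI Nx AB).
  by exists y; split=> //; apply/ABy.
by apply: iA; apply: filterS2 AB iB => y h By; apply/h.
Qed.

Lemma grad_near (f g : pt -> R) x : (\forall y \near x, f y = g y) ->
  grad f x = grad g x.
Proof. by move=> fg; rewrite /grad !(near_eq_derive _ fg). Qed.

End AffineFunctions.

(** * Measure theory of the plane *)

HB.instance Definition _ (R : realType) := Measure.on (@leb2 R).

Section PlaneMeasure.
Context {R : realType}.
Notation pt := (R * R)%type.

(** Measurability refers to the product of the Borel sigma-algebras; an open set belongs to it as a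
    countable union of rational boxes. *)
Lemma plane_open_measurable (U : set pt) : open U -> measurable U.
Proof.
move=> oU.
pose box (q : (rat * rat) * (rat * rat)) : set pt :=
  [set` `]ratr q.1.1 : R, ratr q.1.2[] `*` [set` `]ratr q.2.1 : R, ratr q.2.2[].
have -> : U = \bigcup_(q in [set q | box q `<=` U]) box q.
  apply/seteqP; split => [x Ux|x [q /= qU /qU]//].
  have := open_nbhs_nbhs (conj oU Ux); move=> /nbhs_ballP[e /= e0 eU].
  have h (s : R) : exists2 q : rat * rat, s - e < ratr q.1 &
      ratr q.1 < s /\ s < ratr q.2 /\ ratr q.2 < s + e.
    have /rat_in_itvoo[p] : s - e < s by rewrite ltrBlDr ltrDl.
    have /rat_in_itvoo[p'] : s < s + e by rewrite ltrDl.
    rewrite !in_itv /= => /andP[? ?] /andP[? ?].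
    by exists (p, p').
  have [q1 a1 [b1 [c1 d1]]] := h x.1; have [q2 a2 [b2 [c2 d2]]] := h x.2.
  exists (q1, q2); last by split; rewrite /= in_itv /= ?b1 ?c1 ?b2 ?c2.
  move=> y [] /=; rewrite !in_itv /= => /andP[h1 h2] /andP[h3 h4].
  by apply: eU; split; rewrite /ball /= distrC ltr_distl; apply/andP; split; lra.
rewrite bigcup_mkcond; apply: countable_bigcupT_measurable => //.
move=> q; case: ifP => // _; exact: measurableX.
Qed.

Lemma plane_continuous_measurable (h : pt -> R) :
  continuous h -> measurable_fun setT h.
Proof.
move=> /continuousP ch; apply: (measurability _ (RGenOpens.measurableE R)).
move=> _ [_ [a [b ->] <-]]; rewrite setTI; apply: plane_open_measurable.
by apply: ch; exact: interval_open.
Qed.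

Lemma leb2X (A B : set R) : measurable A -> measurable B ->
  leb2 (A `*` B) = (lebesgue_measure A * lebesgue_measure B)%E.
Proof. by move=> mA mB; exact: product_measure1E. Qed.

(** Kept general in the measure: it serves for area integrals and for integrals along lines. *)
Lemma bounded_support_integrable d (T : measurableType d)
    (mu : {measure set T -> \bar R}) (A : set T) (f : T -> R) (M : R) :
  measurable A -> (mu A < +oo)%E -> measurable_fun setT f ->
  (forall x, `|f x| <= M) -> (forall x, ~ A x -> f x = 0) ->
  mu.-integrable setT (EFin \o f).
Proof.
move=> mA Aoo mf fM fA.
have -> : EFin \o f = (EFin \o f) \_ A.
  apply/funext => x; rewrite /patch /=; case: ifPn => // /negP xA.
  by rewrite fA// => Ax; apply: xA; rewrite inE.
apply/integrable_restrict => //; rewrite setTI.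
apply: measurable_bounded_integrable => //; first exact: measurable_funTS.
exists M; split; first by rewrite num_real.
by move=> r Mr x _ /=; apply: le_trans (fM x) (ltW Mr).
Qed.

Definition bounded_box (M : R) : set pt := [set x | `|x.1| <= M /\ `|x.2| <= M].

(** The class of representatives: integrable on the plane and along every unit-speed line. One
    constant bounds both the values and the support. *)
Definition nice (g : pt -> R) := measurable_fun setT g /\
  exists M : R, (forall x, `|g x| <= M) /\ (forall x, ~ bounded_box M x -> g x = 0).

Lemma boxE M : bounded_box M =
  [set` `[- M, M]] `*` [set` `[- M, M]].
Proof.
by apply/seteqP; split => x; rewrite /bounded_box /= !in_itv /= !ler_norml.
Qed.

Lemma le_box (M N : R) x : M <= N -> bounded_box M x -> bounded_box N x.
Proof. by move=> MN [h1 h2]; split; [apply: le_trans h1 MN|apply: le_trans h2 MN]. Qed.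

Lemma box_compact M : compact (bounded_box M).
Proof. rewrite boxE; apply: compact_setX; exact: segment_compact. Qed.

Lemma nice_integrable g : nice g -> (@leb2 R).-integrable setT (EFin \o g).
Proof.
move=> [mg [M [gM gs]]].
have h := @bounded_support_integrable _ _
  (@leb2 R : {measure set _ -> \bar R}) (bounded_box M) g M; apply: h => //.
  by rewrite boxE; apply: measurableX.
pose I : set R := [set` `[- M, M]].
have E : leb2 (bounded_box M) = (lebesgue_measure I * lebesgue_measure I)%E.
  by rewrite boxE; exact: leb2X.
change (leb2 (bounded_box M) < +oo)%E; rewrite E /I !lebesgue_measure_itv/=.
by case: ifP => _; rewrite ?mule0// -EFinB -EFinM ltry.
Qed.

Lemma line_measurable (l : pt * pt) :
  measurable_fun setT (fun t : R => (l.1 + t *: l.2 : pt)).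
Proof.
apply/measurable_fun_pairP; split; apply: continuous_measurable_fun => t /=.
  by apply: cvgD; [exact: cvg_cst|apply: cvgZr_tmp; exact: cvg_id].
by apply: cvgD; [exact: cvg_cst|apply: cvgZr_tmp; exact: cvg_id].
Qed.

(** A line of unit speed stays in a bounded box only for a bounded time. *)
Lemma nice_line_integrable g (l : pt * pt) : nice g -> dot l.2 l.2 = 1 ->
  (@lebesgue_measure R).-integrable setT (EFin \o (fun t => g (l.1 + t *: l.2))).
Proof.
move=> [mg [M [gM gs]]] l1.
pose K := (M + `|l.1.1|) + (M + `|l.1.2|).
pose I : set R := [set` `[- K, K]].
have h := @bounded_support_integrable _ _ (@lebesgue_measure R) I
  (fun t => g (l.1 + t *: l.2)) M.
have mI : measurable I by exact: measurable_itv.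
have Ioo : (lebesgue_measure I < +oo)%E.
  by rewrite /I lebesgue_measure_itv/=; case: ifP => _; rewrite -?EFinB ltry.
apply: h => //.
- exact: (measurableT_comp mg (line_measurable l)).
- move=> t ht; apply: gs => -[/= h1 h2]; apply: ht.
  rewrite /I /= in_itv /= -ler_norml.
  have [u1 u2] : `|l.2.1| <= 1 /\ `|l.2.2| <= 1.
    move: l1; rewrite /dot -!expr2 => l1.
    by split; rewrite -(@ler_sqr _ `|_| 1) ?nnegrE// ?real_normK ?num_real//;
      rewrite expr1n -l1 ?lerDl ?lerDr sqr_ge0.
  (* The parameter is recovered from the point by projecting on the unit direction; this explains
     the bound [K]. *)
  have -> : t = (l.1.1 + t *: l.2.1 - l.1.1) * l.2.1 + (l.1.2 + t *: l.2.2 - l.1.2) * l.2.2.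
    by rewrite !scaleRE -[LHS]mulr1 -l1 /dot; ring.
  apply: le_trans (ler_normD _ _) _; rewrite !normrM /K.
  apply: lerD.
  - rewrite -[leRHS]mulr1; apply: ler_pM => //.
    by apply: le_trans (ler_normB _ _) _; rewrite lerD2r.
  - rewrite -[leRHS]mulr1; apply: ler_pM => //.
    by apply: le_trans (ler_normB _ _) _; rewrite lerD2r.
Qed.

Lemma niceD (g h : pt -> R) : nice g -> nice h -> nice (fun x => g x + h x).
Proof.
move=> [m1 [M1 [b1 s1]]] [m2 [M2 [b2 s2]]]; split; first exact: measurable_funD.
have M10 : 0 <= M1 := le_trans (normr_ge0 _) (b1 0).
have M20 : 0 <= M2 := le_trans (normr_ge0 _) (b2 0).
exists (M1 + M2); split => x; first by apply: le_trans (ler_normD _ _) _; exact: lerD.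
move=> bx; rewrite s1 ?s2 ?addr0// => bx'; apply: bx; apply: le_box bx';
  by rewrite ?lerDl ?lerDr.
Qed.

Lemma nice_sum (I : Type) (r : seq I) (P : pred I) (F : I -> pt -> R) :
  (forall i, P i -> nice (F i)) -> nice (fun x => \sum_(i <- r | P i) F i x).
Proof.
move=> nF; elim: r => [|i r IH].
  under eq_fun do rewrite big_nil.
  by split; [exact: measurable_cst|exists 0; split => // x; rewrite normr0].
under eq_fun do rewrite big_cons.
by case: (boolP (P i)) => Pi //; apply: niceD => //; exact: nF.
Qed.

(** The continuous factor is bounded on the compact box that carries [g]. *)
Lemma nice_mul_continuous (g h : pt -> R) : nice g -> continuous h -> nice (fun x => g x * h x).
Proof.
move=> [mg [M [gM gs]]] ch; split.
  by apply: measurable_funM => //; exact: plane_continuous_measurable.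
have M0 : 0 <= M := le_trans (normr_ge0 _) (gM 0).
have : bounded_set (h @` bounded_box M).
  apply: compact_bounded; apply: continuous_compact; last exact: box_compact.
  exact: continuous_subspaceT.
move=> [N [_ hN]].
have {}hN x : bounded_box M x -> `|h x| <= `|N| + 1.
  move=> bx; apply: (hN (`|N| + 1)); last by exists x.
  by rewrite ltr_pwDr// ler_norm.
(* The summand [M] keeps the new box at least as large as the old one. *)
exists (M * (`|N| + 1) + M); split => x.
  have [bx|nbx] := pselect (bounded_box M x); last first.
    by rewrite gs// mul0r normr0; have := normr_ge0 N; nra.
  rewrite normrM; apply: (@le_trans _ _ (M * (`|N| + 1))); last by rewrite lerDl.
  by apply: ler_pM => //; exact: hN.
move=> nbx; rewrite gs ?mul0r// => bx; apply: nbx; apply: le_box bx.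
by rewrite lerDr; have := normr_ge0 N; nra.
Qed.

Lemma nice_mul_bounded (g h : pt -> R) : nice g -> measurable_fun setT h ->
  (exists K : R, forall x, `|h x| <= K) -> nice (fun x => g x * h x).
Proof.
move=> [mg [M [gM gs]]] mh [K hK]; split; first exact: measurable_funM.
have M0 : 0 <= M := le_trans (normr_ge0 _) (gM 0).
have K0 : 0 <= K := le_trans (normr_ge0 _) (hK 0).
exists (M * K + M); split => x.
  rewrite normrM; apply: (@le_trans _ _ (M * K)); last by rewrite lerDl.
  exact: ler_pM.
move=> nbx; rewrite gs ?mul0r// => bx; apply: nbx; apply: le_box bx.
by rewrite lerDr mulr_ge0.
Qed.

Lemma nice_indic_mul g (A : set pt) : nice g -> measurable A ->
  nice (fun x => g x * \1_A x).
Proof.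
move=> ng mA; apply: nice_mul_bounded => //; exists 1 => x.
by rewrite indicE; case: (_ \in _); rewrite ?normr0 ?normr1.
Qed.

(** This is how [kappa], controlled in [Om] alone, enters the integrals: cut off to a bounded
    measurable part of [Om]. *)
Lemma nice_restrict (Om A : set pt) (kappa : pt -> R) (K M : R) :
  measurable_fun Om kappa -> measurable Om -> measurable A -> A `<=` Om ->
  (forall x, Om x -> `|kappa x| <= K) -> A `<=` bounded_box M ->
  nice (kappa \_ A).
Proof.
move=> mk mOm mA AO kK AM; split.
  by apply: (measurable_restrictT kappa mA).1; exact: (measurable_funS mOm AO mk).
exists (`|K| + `|M|); split => x; rewrite /patch; case: ifPn => xA.
- rewrite inE in xA; apply: le_trans (kK _ (AO _ xA)) _.
  by apply: le_trans (ler_norm _) _; rewrite lerDl.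
- by rewrite normr0 addr_ge0.
- rewrite inE in xA; move=> []; apply: le_box (AM _ xA).
  by apply: le_trans (ler_norm _) _; rewrite lerDr.
- by [].
Qed.

(** The product is dominated by [|g| + M f^2], because [u <= 1 + u^2]. *)
Lemma L2_nice_integrable (Om : set pt) (f g : pt -> R) :
  L2 Om f -> nice g ->
  (@leb2 R).-integrable setT (EFin \o (fun x => (f \_ Om) x * g x)).
Proof.
move=> fL2 ng.
have if2 := Lfun2_integrable_sqr fL2.
have mf : measurable_fun setT (f \_ Om).
  by move: fL2; rewrite /L2 inE => /andP[/[!inE]/=].
have [mg [M [gM gs]]] := ng.
have M0 : 0 <= M := le_trans (normr_ge0 _) (gM 0).
have ng2 : nice (fun x => `|g x|).
  split; first exact: measurableT_comp mg.
  exists M; split => x; first by rewrite normr_id.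
  by move=> /gs ->; rewrite normr0.
have i1 := nice_integrable ng2.
have i2 := integrableZl measurableT M if2.
apply: le_integrable (integrableD measurableT i1 i2) => //.
  by apply/measurable_EFinP; exact: measurable_funM.
move=> x _ /=. rewrite lee_fin.
have h0 := sqr_ge0 ((f \_ Om) x).
rewrite [X in _ <= X]ger0_norm; last by rewrite addr_ge0// mulr_ge0.
rewrite normrM; have := gM x; have := normr_ge0 (g x).
have : (f \_ Om) x ^+ 2 = `|(f \_ Om) x| ^+ 2 by rewrite real_normK ?num_real.
move=> ->; move: `|(f \_ Om) x| `|g x| (normr_ge0 ((f \_ Om) x)) => u v u0 v0 vM.
have : v <= v * (1 - u) + v * u by lra.
have : 0 <= (u - 1) ^+ 2 by rewrite sqr_ge0.
nra.
Qed.

(** A vertical line is the product of a point and the real axis; any other line has one-point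
    sections over the first coordinate. *)
Lemma plane_line_null (a : pt -> R) : affine a -> alin a != 0 ->
  measurable [set x | a x = 0] /\ leb2 [set x | a x = 0] = 0%E.
Proof.
move=> ha a0.
have mA : measurable [set x | a x = 0].
  rewrite (_ : mkset _ = a @^-1` [set 0]) //.
  rewrite -[X in measurable X]setTI.
  by apply: plane_continuous_measurable => //; exact: affine_continuous.
split=> //.
have [e|e] := eqVneq (alin a).2 0.
  have e1 : (alin a).1 != 0.
    by apply: contra a0 => /eqP e1; apply/eqP/ptP.
  rewrite (_ : mkset _ = [set - a 0 / (alin a).1] `*` setT).
    apply: eq_trans (leb2X _ _) _ => //.
    rewrite lebesgue_measure_set1; exact: mul0e.
  apply/seteqP; split => x /=; rewrite (ha x) /dot e mul0r addr0.
    by move=> h; split => //; apply: (mulfI e1); rewrite [RHS]mulrCA mulfV// mulr1; lra.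
  move=> [-> _].
  by rewrite mulrCA mulfV// mulr1 addNr.
rewrite /leb2 /product_measure1 /=.
rewrite (eq_integral (fun=> 0%E)) ?integral0// => s _ /=.
have ht t : a (s, t) = (alin a).1 * s + (alin a).2 * t + a 0 by rewrite (ha (s, t)).
move: (alin a).1 (alin a).2 (a 0) e ht => p1 p2 c e ht.
rewrite (_ : xsection _ _ = [set (- c - p1 * s) / p2]).
  exact: lebesgue_measure_set1.
apply/seteqP; split => t /=; rewrite /xsection /= inE /= ht.
  by move=> h; apply: (mulfI e); rewrite [RHS]mulrCA mulfV// mulr1; lra.
by move=> ->; rewrite mulrCA mulfV// mulr1; lra.
Qed.

End PlaneMeasure.

(** * Line integrals *)

Section LineIntegrals.
Context {R : realType}.
Notation pt := (R * R)%type.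

Definition line_at (l : pt * pt) (t : R) : pt := l.1 + t *: l.2.

Lemma line_at_inj (l : pt * pt) : lines l -> injective (line_at l).
Proof.
case=> l1 _ _ s t /addrI e.
have : dot l.2 (s *: l.2) = dot l.2 (t *: l.2) by rewrite e.
by rewrite !dotZr l1 !mulr1.
Qed.

Definition lines_in (a : pt -> R) : set (pt * pt) :=
  [set l | lines l /\ forall t, a (line_at l t) = 0].

(** Normal form of a parametrization: its base point is the foot of the perpendicular from the
    origin, and its direction is one of the two unit vectors orthogonal to the gradient. *)
Lemma finite_lines_in (a : pt -> R) : affine a -> alin a != 0 ->
  finite_set (lines_in a).
Proof.
move=> ha a0; set p := alin a in a0; set D := dot p p.
have D0 : 0 < D by exact: dot_gt0.
(* For a unit direction [u] orthogonal to [p], the number [s] is the inner product of [rot90 p] and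
   [u], equal to plus or minus [vlen p]. *)
pose F (s : R) : pt * pt := ((- a 0 / D) *: p, (s / D) *: rot90 p).
apply: (@sub_finite_set _ _ (F @` [set vlen p; - vlen p])); last first.
  by apply: finite_image; exact: finite_set2.
move=> [q u] [[/= u1 qu _] z].
have pu : dot p u = 0.
  have := z 1; have := z 0; rewrite /line_at !affine_ray// -/p mul0r addr0 mul1r => ->.
  by rewrite add0r.
have pq : dot p q = - a 0.
  have := z 0; rewrite /line_at scale0r addr0 /= ha -/p => h.
  by apply/eqP; rewrite -addr_eq0; apply/eqP.
set s := dot (rot90 p) u.
have DE : D = p.1 * p.1 + p.2 * p.2 by [].
have ss : s ^+ 2 = D.
  have : s ^+ 2 = D * dot u u - dot p u ^+ 2 by rewrite /s DE /dot /rot90 /=; ring.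
  by rewrite u1 pu => ->; ring.
have Dn : D != 0 by rewrite gt_eqF.
have uE : u = (s / D) *: rot90 p.
  have h1 : D * u.1 = s * (rot90 p).1.
    have : D * u.1 = p.1 * dot p u + s * (rot90 p).1 by rewrite /s DE /dot /rot90 /=; ring.
    by rewrite pu mulr0 add0r.
  have h2 : D * u.2 = s * (rot90 p).2.
    have : D * u.2 = p.2 * dot p u + s * (rot90 p).2 by rewrite /s DE /dot /rot90 /=; ring.
    by rewrite pu mulr0 add0r.
  by apply: ptP; rewrite [RHS]/= scaleRE; apply: (mulfI Dn);
    rewrite ?h1 ?h2 [RHS]mulrA [D * _]mulrC mulfVK.
have s0 : s != 0 by rewrite -sqrf_eq0 ss.
have rq : dot (rot90 p) q = 0.
  move: qu; rewrite {1}uE dotZr dotC => /eqP; rewrite mulf_eq0 mulf_eq0 (negPf s0) invr_eq0 (negPf Dn).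
  by move=> /eqP.
have qE : q = (- a 0 / D) *: p.
  rewrite -pq.
  have h1 : D * q.1 = dot p q * p.1.
    have : D * q.1 = dot p q * p.1 - p.2 * dot (rot90 p) q by rewrite DE /dot /rot90 /=; ring.
    by rewrite rq mulr0 subr0.
  have h2 : D * q.2 = dot p q * p.2.
    have : D * q.2 = dot p q * p.2 + p.1 * dot (rot90 p) q by rewrite DE /dot /rot90 /=; ring.
    by rewrite rq mulr0 addr0.
  by apply: ptP; rewrite [RHS]/= scaleRE; apply: (mulfI Dn);
    rewrite ?h1 ?h2 [RHS]mulrA [D * _]mulrC mulfVK.
exists s; last by rewrite /F -uE -qE.
have : s ^+ 2 == vlen p ^+ 2 by rewrite sqr_sqrtr ?ltW// ss.
by rewrite eqf_sqr => /orP[/eqP|/eqP]; [left|right].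
Qed.

Lemma line_zeros_finite (a : pt -> R) (l : pt * pt) : affine a -> lines l ->
  ~ lines_in a l -> finite_set [set t | a (line_at l t) = 0].
Proof.
move=> ha ll nl.
have aE t : a (line_at l t) = a l.1 + t * dot (alin a) l.2 by exact: affine_ray.
have [e|e] := eqVneq (dot (alin a) l.2) 0.
  apply: (@sub_finite_set _ _ set0); last exact: finite_set0.
  move=> t /=; rewrite aE e mulr0 addr0 => h; apply: nl; split=> // s.
  by rewrite aE e mulr0 addr0.
apply: (@sub_finite_set _ _ [set - a l.1 / dot (alin a) l.2]); last exact: finite_set1.
move=> t /=; rewrite aE => h; apply: (mulIf e); rewrite mulfVK//.
by apply/eqP; rewrite -addr_eq0 addrC h.
Qed.

(** Constant members are excluded, since one that vanishes identically would contribute every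
    line. *)
Definition lines_of (I : Type) (c : I -> pt -> R) : set (pt * pt) :=
  \bigcup_(i in [set i | alin (c i) != 0]) lines_in (c i).

Definition zeros_of (I : Type) (c : I -> pt -> R) : set pt :=
  [set x | exists2 i, alin (c i) != 0 & c i x = 0].

Lemma finite_null_modification (N D : set R) (f g : R -> R) :
  finite_set N -> (forall t, ~ N t -> (f \_ D) t = g t) ->
  \int[lebesgue_measure]_(t in D) f t = \int[lebesgue_measure]_t g t.
Proof.
move=> fN; have cN : countable N by exact: finite_set_countable.
apply: (@Rintegral_null_modification _ _ _ (@lebesgue_measure R)).
  exact: countable_measurable.
exact: countable_lebesgue_measure0.
Qed.

(** Brings every line integral to one form: whole-line integrals over the same finite set of lines,
    with an integrand that is free on a finite set [E]. Any other line meets [B] in finitely many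
    points and contributes zero. *)
Lemma lint_repr (I : finType) (c : I -> pt -> R) (B E : set pt) (h g : pt -> R) :
  (forall i, affine (c i)) -> finite_set E -> B `<=` zeros_of c ->
  (forall x, ~ E x -> (h \_ B) x = g x) ->
  lint B h = \sum_(l \in lines_of c) \int[lebesgue_measure]_t g (line_at l t).
Proof.
move=> ca fE Bc hg; rewrite /lint.
transitivity (\sum_(l \in lines_of c)
   \int[@lebesgue_measure R]_(t in [set t : R | B (line_at l t)]) h (line_at l t)).
  apply/esym/fsbig_widen; first by move=> l [i _ []].
  move=> l [ll nl] /=.
  have fz : finite_set [set t | zeros_of c (line_at l t)].
    have -> : [set t | zeros_of c (line_at l t)] =
      \bigcup_(i in [set i | alin (c i) != 0]) [set t | c i (line_at l t) = 0].
      by apply/seteqP; split => t /= [i ? ?]; exists i.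
    apply: bigcup_finite => [|i /= ci]; first exact: finite_finset.
    by apply: line_zeros_finite => // li; apply: nl; exists i.
  rewrite (finite_null_modification (g := cst 0) fz).
    by rewrite Rintegral_cst// mul0r.
  move=> t /= nz; rewrite /patch; case: ifPn => // /[1!inE] /= Bt.
  by case: nz; exact: Bc.
apply: eq_fsbigr => l; rewrite inE => -[i _ [ll _]].
have fN : finite_set (line_at l @^-1` E).
  by apply: finite_preimage fE => s t _ _; exact: line_at_inj.
apply: (finite_null_modification fN) => t nE.
rewrite -hg// /patch; congr (if _ then _ else _).
Qed.

Lemma finite_lines_of (I : finType) (c : I -> pt -> R) :
  (forall i, affine (c i)) -> finite_set (lines_of c).
Proof.
move=> ca; apply: bigcup_finite => [|i /= ci]; first exact: finite_finset.
exact: finite_lines_in.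
Qed.

Lemma lines_of_unit (I : finType) (c : I -> pt -> R) l :
  lines_of c l -> dot l.2 l.2 = 1.
Proof. by case=> i _ [[]]. Qed.

Lemma sum_line_integrals (I J : finType) (c : I -> pt -> R) (P : pred J)
    (g : J -> pt -> R) :
  (forall i, affine (c i)) -> (forall j, P j -> nice (g j)) ->
  \sum_(l \in lines_of c)
     \int[lebesgue_measure]_t (\sum_(j | P j) g j (line_at l t)) =
  \sum_(j | P j) \sum_(l \in lines_of c)
     \int[lebesgue_measure]_t g j (line_at l t).
Proof.
move=> ca ng; have fL := finite_lines_of ca.
rewrite fsbig_finite//; under [RHS]eq_bigr do rewrite fsbig_finite//.
rewrite exchange_big /=; apply: eq_big_seq => l.
rewrite in_fset_set// => /set_mem h; have l1 := lines_of_unit h.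
apply: (@Rintegral_sum _ _ _ (@lebesgue_measure R) _ _ _
  (fun j t => g j (line_at l t)) _).2 => j Pj.
by apply: nice_line_integrable => //; exact: ng.
Qed.

End LineIntegrals.

(** * Polynomials *)

Section Polynomials.
Context {R : realType}.
Notation pt := (R * R)%type.
Implicit Types p q : pt -> R.

(** Continuity of all directional derivatives is what makes products with [grad p] continuous, hence
    [nice] after a cut-off. *)
Definition C1 p := continuous p /\
  forall v, (forall x, derivable p x v) /\ continuous (fun x => 'D_v p x).

Lemma C1_cst (c : R) : C1 (fun=> c).
Proof.
split; first exact: cst_continuous.
move=> v; split => [x|]; first exact: derivable_cst.
by under eq_fun do rewrite derive_cst; exact: cst_continuous.
Qed.

Lemma is_derive_affine (a : pt -> R) x v : affine a ->
  is_derive x v a (dot (alin a) v).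
Proof.
move=> ha.
have h : (fun h : R => h^-1 *: ((a \o shift x) (h *: v) - a x)) @ 0^' -->
    dot (alin a) v.
  apply: cvg_near_cst; near=> h.
  have h0 : h != 0 by near: h; exact: nbhs_dnbhs_neq.
  by rewrite /= [h *: v + x]addrC affine_ray// addrAC subrr add0r scaleRE mulKf.
by apply: DeriveDef; [apply/cvg_ex; exists (dot (alin a) v)|exact: cvg_lim].
Unshelve. all: by end_near. Qed.

Lemma C1_affine (a : pt -> R) : affine a -> C1 a.
Proof.
move=> ha; split; first exact: affine_continuous.
move=> v; split => [x|].
  by have [] := is_derive_affine x v ha.
have -> : (fun x => 'D_v a x) = fun=> dot (alin a) v.
  by apply/funext => x; have [_ ->] := is_derive_affine x v ha.
exact: cst_continuous.
Qed.

Lemma affine_fst : affine (fun x : pt => x.1).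
Proof. by move=> x; rewrite /dot /alin /=; ring. Qed.

Lemma affine_snd : affine (fun x : pt => x.2).
Proof. by move=> x; rewrite /dot /alin /=; ring. Qed.

Lemma C1D p q : C1 p -> C1 q -> C1 (fun x => p x + q x).
Proof.
move=> [cp dp] [cq dq]; split; first by move=> x; apply: cvgD; [exact: cp|exact: cq].
move=> v; have [dp1 dp2] := dp v; have [dq1 dq2] := dq v; split => [x|].
  exact: (derivableD (dp1 x) (dq1 x)).
rewrite (_ : 'D_v _ = fun x => 'D_v p x + 'D_v q x); last first.
  by apply/funext => x; exact: (deriveD (dp1 x) (dq1 x)).
by move=> x; apply: cvgD; [exact: dp2|exact: dq2].
Qed.

Lemma C1M p q : C1 p -> C1 q -> C1 (fun x => p x * q x).
Proof.
move=> [cp dp] [cq dq]; split; first by move=> x; apply: cvgM; [exact: cp|exact: cq].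
move=> v; have [dp1 dp2] := dp v; have [dq1 dq2] := dq v; split => [x|].
  exact: (derivableM (dp1 x) (dq1 x)).
rewrite (_ : 'D_v _ = fun x => p x * 'D_v q x + q x * 'D_v p x); last first.
  by apply/funext => x; exact: (deriveM (dp1 x) (dq1 x)).
move=> x; apply: cvgD; apply: cvgM;
  [exact: cp|exact: dq2|exact: cq|exact: dp2].
Qed.

Lemma C1X p n : C1 p -> C1 (fun x => p x ^+ n).
Proof.
move=> cp; elim: n => [|n IH].
  by under eq_fun do rewrite expr0; exact: C1_cst.
by under eq_fun do rewrite exprS; exact: C1M.
Qed.

Lemma C1_sum (I : Type) (r : seq I) (P : pred I) (F : I -> pt -> R) :
  (forall i, P i -> C1 (F i)) -> C1 (fun x => \sum_(i <- r | P i) F i x).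
Proof.
move=> CF; elim: r => [|i r IH].
  by under eq_fun do rewrite big_nil; exact: C1_cst.
under eq_fun do rewrite big_cons.
by case: (boolP (P i)) => Pi //; apply: C1D => //; exact: CF.
Qed.

Lemma Pk_C1 k p : Pk k p -> C1 p.
Proof.
move=> [c pE]; rewrite (_ : p = fun x => \sum_(i < k.+1)
  \sum_(j < k.+1 | (i + j <= k)%N) c i j * x.1 ^+ i * x.2 ^+ j); last exact/funext.
apply: C1_sum => i _; apply: C1_sum => j _.
apply: C1M; last by apply: C1X; apply: C1_affine; exact: affine_snd.
apply: C1M; first exact: C1_cst.
by apply: C1X; apply: C1_affine; exact: affine_fst.
Qed.

Lemma C1_grad_dot p (n : pt) : C1 p -> continuous (fun x => dot (grad p x) n).
Proof.
move=> [_ dp]; rewrite /dot /grad /= => x.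
by apply: cvgD; (apply: cvgM; last exact: cvg_cst); [apply: (dp (1, 0)).2|apply: (dp (0, 1)).2].
Qed.

Lemma C1_grad_grad p q : C1 p -> C1 q ->
  continuous (fun x => dot (grad p x) (grad q x)).
Proof.
move=> [_ dp] [_ dq]; rewrite /dot /grad /= => x.
by apply: cvgD; apply: cvgM; [apply: (dp (1, 0)).2|apply: (dq (1, 0)).2|
  apply: (dp (0, 1)).2|apply: (dq (0, 1)).2].
Qed.

Lemma grad_cst (c : R) x : grad (fun=> c) x = 0.
Proof. by rewrite /grad !derive_cst. Qed.

Lemma PkD k p q : Pk k p -> Pk k q -> Pk k (fun x => p x + q x).
Proof.
move=> [c cE] [d dE]; exists (fun i j => c i j + d i j) => x.
rewrite cE dE -big_split /=; apply: eq_bigr => i _.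
by rewrite -big_split /=; apply: eq_bigr => j _; rewrite !mulrDl.
Qed.

Lemma Pk_monomial k (m n : nat) (a : R) : (m + n <= k)%N ->
  Pk k (fun x => a * x.1 ^+ m * x.2 ^+ n).
Proof.
move=> mnk; exists (fun i j => if (i == m) && (j == n) then a else 0) => x.
have mk : (m < k.+1)%N by rewrite ltnS (leq_trans (leq_addr _ _) mnk).
have nk : (n < k.+1)%N by rewrite ltnS (leq_trans (leq_addl _ _) mnk).
rewrite (bigD1 (Ordinal mk)) //= (bigD1 (Ordinal nk)) //= !eqxx /=.
rewrite big1 ?addr0 => [|j /andP[_ jn]]; last first.
  by rewrite -val_eqE /= in jn; rewrite (negPf jn) !mul0r.
rewrite big1 ?addr0// => i im; rewrite big1// => j _.
by rewrite -val_eqE /= in im; rewrite (negPf im) !mul0r.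
Qed.

Lemma Pk0 k : Pk k (fun=> 0 : R).
Proof.
exists (fun _ _ => 0) => x; rewrite big1// => i _.
by rewrite big1// => j _; rewrite !mul0r.
Qed.

Lemma Pk_cst k (c : R) : Pk k (fun=> c).
Proof.
have := @Pk_monomial k 0 0 c (leq0n _).
by under eq_fun do rewrite !expr0 !mulr1.
Qed.

Lemma Pk_sum k (I : Type) (r : seq I) (P : pred I) (F : I -> pt -> R) :
  (forall i, P i -> Pk k (F i)) -> Pk k (fun x => \sum_(i <- r | P i) F i x).
Proof.
move=> PF; elim: r => [|i r IH].
  by under eq_fun do rewrite big_nil; exact: Pk0.
under eq_fun do rewrite big_cons.
by case: (boolP (P i)) => Pi //; apply: PkD => //; exact: PF.
Qed.

Lemma Pk_mul_affine k p (a : pt -> R) : Pk k p -> affine a ->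
  Pk k.+1 (fun x => a x * p x).
Proof.
move=> [c cE] ha.
rewrite (_ : (fun x => _) = fun x => \sum_(i < k.+1)
  \sum_(j < k.+1 | (i + j <= k)%N) ((alin a).1 * c i j * x.1 ^+ i.+1 * x.2 ^+ j +
     ((alin a).2 * c i j * x.1 ^+ i * x.2 ^+ j.+1 +
      a 0 * c i j * x.1 ^+ i * x.2 ^+ j))); last first.
  apply/funext => x; rewrite cE mulr_sumr; apply: eq_bigr => i _.
  rewrite mulr_sumr; apply: eq_bigr => j _.
  by rewrite (ha x) /dot !exprS; ring.
apply: Pk_sum => i _; apply: Pk_sum => j ij.
apply: PkD; first by apply: Pk_monomial; rewrite addSn ltnS.
by apply: PkD; apply: Pk_monomial; rewrite ?addnS ?ltnS// leqW.
Qed.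

(** True for every [u], because the default value of [restr] is a constant. *)
Lemma restr_C1 k (V : 'I_3 -> pt) (u : pt -> R) : C1 (restr k V u).
Proof.
rewrite /restr; case: xgetP => [p _ [pk _]|_]; first exact: Pk_C1 pk.
exact: C1_cst.
Qed.

End Polynomials.

(** * Barycentric coordinates *)

Section Index3.

Lemma I3P (P : 'I_3 -> Prop) : P ord0 -> P (inord 1) -> P (inord 2) -> forall i, P i.
Proof.
move=> p0 p1 p2 [[|[|[|//]]] hi].
- by rewrite (_ : Ordinal hi = ord0)//; exact: val_inj.
- by rewrite (_ : Ordinal hi = inord 1)//; apply: val_inj; rewrite /= inordK.
- by rewrite (_ : Ordinal hi = inord 2)//; apply: val_inj; rewrite /= inordK.
Qed.

Lemma sum3E (V : nmodType) (F : 'I_3 -> V) :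
  \sum_i F i = F ord0 + F (inord 1) + F (inord 2).
Proof.
rewrite !big_ord_recl big_ord0 addr0 addrA; congr (_ + F _ + F _);
  by apply: val_inj; rewrite /= inordK.
Qed.

Lemma I3_third (i j : 'I_3) : i != j -> exists m, m != i /\ m != j.
Proof.
by case: i j => [[|[|[|//]]] hi] [[|[|[|//]]] hj] // _;
  first [by exists (@Ordinal 3 0 isT)|by exists (@Ordinal 3 1 isT)|by exists (@Ordinal 3 2 isT)].
Qed.

Lemma I3_two_others (i : 'I_3) : exists j m, [/\ j != i, m != i & j != m].
Proof.
case: i => [[|[|[|//]]] hi].
- by exists (@Ordinal 3 1 isT), (@Ordinal 3 2 isT).
- by exists (@Ordinal 3 0 isT), (@Ordinal 3 2 isT).
- by exists (@Ordinal 3 0 isT), (@Ordinal 3 1 isT).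
Qed.

Lemma I3_cover (i j m n : 'I_3) : i != j -> m != i -> m != j ->
  [\/ n = i, n = j | n = m].
Proof.
move=> ij mi mj.
have [->|ni] := eqVneq n i; first exact: Or31.
have [->|nj] := eqVneq n j; first exact: Or32.
apply: Or33; apply: val_inj; move: ij mi mj ni nj.
by case: i j m n => [[|[|[|//]]] ?] [[|[|[|//]]] ?] [[|[|[|//]]] ?] [[|[|[|//]]] ?].
Qed.

Lemma sum3 (V : nmodType) (F : 'I_3 -> V) (i j m : 'I_3) :
  i != j -> m != i -> m != j -> \sum_n F n = F i + F j + F m.
Proof.
move=> ij mi mj; rewrite (bigD1 i)//= (bigD1 j) 1?eq_sym//= (bigD1 m) ?mi//=.
rewrite big1 ?addr0 ?addrA// => n /andP[/andP[ni nj] nm].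
by case: (I3_cover n ij mi mj) => e; rewrite e eqxx in ni nj nm.
Qed.

End Index3.

Section Barycentric.
Context {R : realType}.
Notation pt := (R * R)%type.
Implicit Types (V : 'I_3 -> pt) (x y : pt).

Definition cross (p q : pt) : R := dot (rot90 p) q.

(** Cramer's rule: quotients of signed areas. The coordinate of index [ord0] is the complement of
    the other two, which gives the sum 1 at once. *)
Definition bary V (i : 'I_3) x : R :=
  let D := cross (V (inord 1) - V ord0) (V (inord 2) - V ord0) in
  let b1 := cross (x - V ord0) (V (inord 2) - V ord0) / D in
  let b2 := cross (V (inord 1) - V ord0) (x - V ord0) / D in
  if i == ord0 then 1 - b1 - b2 else if i == inord 1 then b1 else b2.

Let n10 : (inord 1 == ord0 :> 'I_3) = false.
Proof. by rewrite -val_eqE /= inordK. Qed.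
Let n20 : (inord 2 == ord0 :> 'I_3) = false.
Proof. by rewrite -val_eqE /= inordK. Qed.
Let n21 : (inord 2 == inord 1 :> 'I_3) = false.
Proof. by rewrite -val_eqE /= !inordK. Qed.

Lemma bary_affine V i : affine (bary V i).
Proof.
have h1 : affine (fun x => cross (x - V ord0) (V (inord 2) - V ord0) /
    cross (V (inord 1) - V ord0) (V (inord 2) - V ord0)).
  move=> x; move: (_^-1) => c; rewrite /alin /cross /rot90 /dot /=; ring.
have h2 : affine (fun x => cross (V (inord 1) - V ord0) (x - V ord0) /
    cross (V (inord 1) - V ord0) (V (inord 2) - V ord0)).
  move=> x; move: (_^-1) => c; rewrite /alin /cross /rot90 /dot /=; ring.
rewrite /bary; case: (i == ord0); last by case: (i == inord 1).
by apply: affineB => //; apply: affineB => //; exact: affine_cst.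
Qed.

Lemma bary_sum V x : \sum_i bary V i x = 1.
Proof. by rewrite sum3E /bary eqxx n10 n20 n21 eqxx; ring. Qed.

Lemma bary_comb V x : Defs.nondegenerate V -> x = \sum_i bary V i x *: V i.
Proof.
rewrite /Defs.nondegenerate -/(cross _ _) => nd.
rewrite sum3E /bary eqxx n10 n20 n21 eqxx.
by apply: ptP; rewrite /= !scaleRE; move: nd; rewrite /cross /rot90 /dot /= => nd;
  field; move: nd; rewrite -oppr_eq0; apply: contra => /eqP h; apply/eqP; lra.
Qed.

Lemma bary_vertex V i j : Defs.nondegenerate V -> bary V i (V j) = (i == j)%:R.
Proof.
rewrite /Defs.nondegenerate -/(cross _ _) => nd.
have c0 (p : pt) : cross p p = 0 by rewrite /cross /rot90 /dot /=; ring.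
have z1 (p : pt) : cross p 0 = 0 by rewrite /cross /rot90 /dot /=; ring.
have z2 (p : pt) : cross 0 p = 0 by rewrite /cross /rot90 /dot /=; ring.
by move: j; apply: I3P; move: i; apply: I3P; rewrite /bary ?eqxx ?n10 ?n20 ?n21
  ?(eq_sym ord0) ?(eq_sym (inord 1) (inord 2)) ?n10 ?n20 ?n21 ?eqxx ?subrr ?c0 ?z1 ?z2 ?mul0r
  ?divff ?subr0 ?subrr.
Qed.

Lemma bary_of_comb V (c : 'I_3 -> R) i : Defs.nondegenerate V ->
  \sum_j c j = 1 -> bary V i (\sum_j c j *: V j) = c i.
Proof.
move=> nd c1; rewrite (affine_comb _ (bary_affine V i) c1).
rewrite (bigD1 i)//= bary_vertex// eqxx mulr1 big1 ?addr0// => j ji.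
by rewrite bary_vertex// eq_sym (negPf ji) mulr0.
Qed.

Lemma bary_inj V x y : Defs.nondegenerate V ->
  (forall i, bary V i x = bary V i y) -> x = y.
Proof.
by move=> nd h; rewrite (bary_comb x nd) (bary_comb y nd); apply: eq_bigr => i _; rewrite h.
Qed.

Lemma hullE V : Defs.nondegenerate V -> hull V = [set x | forall i, 0 <= bary V i x].
Proof.
move=> nd; apply/seteqP; split => x /=.
  by move=> [c [c0 c1] -> i]; rewrite bary_of_comb.
by move=> h; exists (fun i => bary V i x); [split=> //; exact: bary_sum|exact: bary_comb].
Qed.

Lemma alin_bary V i : Defs.nondegenerate V -> alin (bary V i) != 0.
Proof.
move=> nd; apply/eqP => e.
have [j [_ [ji _ _]]] := I3_two_others i.
have := affine_sub (V i) (V j) (bary_affine V i).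
rewrite e !bary_vertex// eqxx eq_sym (negPf ji) /dot /= !mul0r addr0 => h.
by have := oner_neq0 R; rewrite -oppr_eq0 => /eqP; apply; rewrite -h; ring.
Qed.

Lemma near_ge0_affine_pos (a : pt -> R) x : affine a -> alin a != 0 ->
  (\forall y \near x, 0 <= a y) -> 0 < a x.
Proof.
move=> ha a0 h; rewrite lt_neqAle (nbhs_singleton h) andbT; apply/eqP => e.
have [y /= y0] := near_neg_side ha a0 (esym e) h.
by rewrite ltNge y0.
Qed.

Lemma near_all3 x (P : 'I_3 -> set pt) : (forall i, \forall y \near x, P i y) ->
  \forall y \near x, forall i, P i y.
Proof.
move=> h; apply: filterS3 (h ord0) (h (inord 1)) (h (inord 2)) => y h0 h1 h2.
exact: I3P.
Qed.

Lemma near_bary_gt0 V i x : 0 < bary V i x -> \forall y \near x, 0 < bary V i y.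
Proof. by apply: near_gt0; apply: affine_continuous; exact: bary_affine. Qed.

Lemma interior_hullE V : Defs.nondegenerate V ->
  interior (hull V) = [set x | forall i, 0 < bary V i x].
Proof.
move=> nd; rewrite hullE//; apply/seteqP; split => x /= h.
  move=> i; apply: near_ge0_affine_pos (bary_affine V i) (alin_bary i nd) _.
  exact: filterS h.
rewrite /interior /=; have : \forall y \near x, forall i, 0 < bary V i y.
  by apply: near_all3 => i; exact: near_bary_gt0.
by apply: filterS => y h' i; exact: ltW.
Qed.

Lemma affine_ge0_closed (a : pt -> R) : affine a -> closed [set x | 0 <= a x].
Proof.
move=> ha; apply: (@closed_comp _ _ a [set t | 0 <= t]); last exact: closed_ge.
by move=> x _; exact: affine_continuous.
Qed.

Lemma closed_hull V : Defs.nondegenerate V -> closed (hull V).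
Proof.
move=> nd; rewrite hullE// (_ : mkset _ = \bigcap_i [set x | 0 <= bary V i x]).
  by apply: closed_bigI => i _; apply: affine_ge0_closed; exact: bary_affine.
by apply/seteqP; split => x /= h i; [move=> _|]; exact: h.
Qed.

Lemma frontier_hullE V : Defs.nondegenerate V ->
  frontier (hull V) = [set x | hull V x /\ exists i, bary V i x = 0].
Proof.
move=> nd; rewrite /frontier interior_hullE// -(closure_id _).1; last exact: closed_hull.
apply/seteqP; split => x /= [hx h]; split => //.
  apply: contrapT => nz; apply: h => i; rewrite lt_neqAle.
  move: hx; rewrite hullE//= => ->; rewrite andbT; apply/eqP => e.
  by apply: nz; exists i.
by case: h => i e /(_ i); rewrite e ltxx.
Qed.

Lemma hull_bounded V : exists M : R, hull V `<=` bounded_box M.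
Proof.
exists (\sum_i `|(V i).1| + \sum_i `|(V i).2|) => x [c [c0 c1] ->].
have c01 i : `|c i| <= 1.
  rewrite ger0_norm// -c1 (bigD1 i)//= lerDl; exact: sumr_ge0.
split; rewrite ?sum_fst ?sum_snd.
  apply: le_trans (ler_norm_sum _ _ _) _.
  rewrite -[leLHS]addr0; apply: lerD; last by apply: sumr_ge0.
  by apply: ler_sum => i _; rewrite /= scaleRE normrM ler_piMl.
apply: le_trans (ler_norm_sum _ _ _) _.
rewrite -[leLHS]add0r; apply: lerD; first by apply: sumr_ge0.
by apply: ler_sum => i _; rewrite /= scaleRE normrM ler_piMl.
Qed.

End Barycentric.

(** * Dual cells *)

Section DualCells.
Context {R : realType}.
Notation pt := (R * R)%type.
Implicit Types (V S : 'I_3 -> pt) (x y xi : pt).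

Lemma sum_option (I : finType) (W : nmodType) (F : option I -> W) :
  \sum_o F o = F None + \sum_i F (Some i).
Proof.
rewrite (bigD1 None)//=; congr (_ + _).
rewrite (reindex_omap Some id) => [|[i|]//].
by apply: eq_bigl => i; rewrite /= eqxx.
Qed.

(** The part of a triangle cut out around the vertex [i] by barycenter and midpoints is where the
    barycentric coordinate [i] is the largest. *)
Definition quad_weights (i : 'I_3) (nu : 'I_3 -> R) :=
  [/\ forall m, 0 <= nu m, \sum_m nu m = 1 & forall m, nu m <= nu i].

Lemma quadE S i : quad S i =
  [set x | exists2 nu, quad_weights i nu & x = \sum_m nu m *: S m].
Proof.
apply/seteqP; split => x /=.
  move=> [c [c0 c1] ->]; rewrite sum_option in c1.
  (* Each midpoint divides its weight equally between its two ends; [s] is the total that goes to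
     [S i]. *)
  pose s := \sum_j c (Some j) / 2.
  have s0 : 0 <= s by apply: sumr_ge0 => j _; rewrite divr_ge0.
  have sE : s + s = \sum_j c (Some j).
    by rewrite /s -big_split /=; apply: eq_bigr => j _; rewrite -splitr.
  exists (fun m => c None / 3 + c (Some m) / 2 + (m == i)%:R * s).
    split=> [m||m].
    - by rewrite !addr_ge0 ?divr_ge0// mulr_ge0.
    - rewrite big_split big_split /= -/s.
      have -> : \sum_m (m == i)%:R * s = s.
        rewrite (bigD1 i)//= eqxx mul1r big1 ?addr0// => j /negPf ->.
        by rewrite mul0r.
      by rewrite sum3E -addrA sE; lra.
    - have [->|mi] := eqVneq m i; first by rewrite eqxx.
      rewrite eqxx mul0r mul1r addr0.
      have : c (Some m) / 2 <= s.
        rewrite /s (bigD1 m)//= lerDl; apply: sumr_ge0 => j _; exact: divr_ge0.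
      have := c0 (Some i); lra.
  rewrite sum_option /barycenter.
  under [in RHS]eq_bigr do rewrite !scalerDl.
  rewrite !big_split /= -!addrA; congr (_ + _).
    by rewrite scalerA -scaler_sumr.
  rewrite (bigD1 i (P := xpredT) (F := fun m => ((m == i)%:R * s) *: S m))//= eqxx mul1r.
  rewrite [X in _ = _ + (_ + X)]big1 ?addr0 => [|j /negPf ->]; last by rewrite mul0r scale0r.
  rewrite /s scaler_suml -big_split /=; apply: eq_bigr => j _.
  by rewrite /midpoint scalerA scalerDr addrC.
move=> [nu [n0 n1 ni] ->].
have [j [m [ji mi jm]]] := I3_two_others i.
wlog le : j m ji mi jm / nu j <= nu m.
  move=> h; have [?|?] := leP (nu j) (nu m); first exact: (h j m).
  by apply: (h m j) => //; [rewrite eq_sym|exact: ltW].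
have ij : i != j by rewrite eq_sym.
have mj : m != j by rewrite eq_sym.
(* With [nu j <= nu m <= nu i], the barycenter takes three times the smallest weight, the midpoint
   towards [S m] twice the rest of [nu m], and the vertex what remains. The factor for the midpoint
   towards [S j] vanishes. *)
exists (fun o => if o is Some n then
    if n == i then nu i - nu m else 2 * (nu n - nu j) else 3 * nu j).
  split=> [[n|]|].
  - case: eqP => [_|/eqP ni']; first by rewrite subr_ge0.
    case: (I3_cover n ij mi mj) => e; subst n.
    + by rewrite eqxx in ni'.
    + by rewrite subrr mulr0.
    + by rewrite mulr_ge0// subr_ge0.
  - by rewrite mulr_ge0.
  - rewrite sum_option (sum3 _ ij mi mj) eqxx (negPf ji) (negPf mi).
    by rewrite (sum3 _ ij mi mj) in n1; lra.
rewrite sum_option !(sum3 _ ij mi mj) eqxx (negPf ji) (negPf mi).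
rewrite /barycenter (sum3 _ ij mi mj) /midpoint.
by apply: ptP; rewrite /= !scaleRE; field.
Qed.

(** Barycentric displacement from the node, in lattice steps. *)
Definition hexd (k : nat) V xi i x : R := k%:R * (bary V i x - bary V i xi).

Lemma hexd_affine k V xi i : affine (hexd k V xi i).
Proof.
by apply: affineZ; apply: affineB; [exact: bary_affine|exact: affine_cst].
Qed.

Lemma hexd_sum k V xi x : \sum_i hexd k V xi i x = 0.
Proof. by rewrite -mulr_sumr sumrB !bary_sum subrr mulr0. Qed.

Lemma hexd_self k V xi i : hexd k V xi i xi = 0.
Proof. by rewrite /hexd subrr mulr0. Qed.

Section OneElement.
Variables (k : nat) (V : 'I_3 -> pt).
Hypothesis k0 : (0 < k)%N.
Hypothesis nd : Defs.nondegenerate V.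

Let kR : (k%:R : R) != 0.
Proof. by rewrite pnatr_eq0 -lt0n. Qed.

Lemma bary_lattice_pt (a : 'I_3 -> nat) i : (\sum_i a i = k)%N ->
  bary V i (lattice_pt k V a) = (a i)%:R / k%:R.
Proof.
move=> ak; rewrite /lattice_pt bary_of_comb//.
by rewrite -mulr_suml -natr_sum ak divff.
Qed.

Lemma nodes_hull xi : nodes k V xi -> hull V xi.
Proof.
move=> [a /= ak <-]; rewrite hullE//= => i.
by rewrite bary_lattice_pt// divr_ge0.
Qed.

(** In a translate of [V / k], the scaled coordinates are the local weights added to the integer
    position [b]. In the reflected sub-triangles of [bary_down] the weights count backwards from
    [b + 1]. *)
Lemma bary_up (b : 'I_3 -> nat) (nu : 'I_3 -> R) j : (\sum_i b i + 1 = k)%N ->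
  \sum_m nu m = 1 ->
  k%:R * bary V j (\sum_m nu m *: lattice_pt k V (fun i => b i + (i == m))%N) =
  (b j)%:R + nu j.
Proof.
move=> bk n1; rewrite (affine_comb _ (bary_affine V j) n1).
have h m : (\sum_i (b i + (i == m)) = k)%N.
  rewrite big_split /= -bk; congr (_ + _)%N.
  by rewrite (bigD1 m)//= eqxx big1// => i /negPf ->.
under eq_bigr => m _ do rewrite bary_lattice_pt ?h//.
rewrite mulr_sumr; under eq_bigr => m _ do rewrite mulrCA [k%:R * _]mulrC mulfVK// natrD mulrDr.
rewrite big_split /= -mulr_suml n1 mul1r (bigD1 j)//= eqxx mulr1.
by rewrite big1 ?addr0// => m /negPf; rewrite eq_sym => ->; rewrite mulr0.
Qed.

Lemma bary_down (b : 'I_3 -> nat) (nu : 'I_3 -> R) j : (\sum_i b i + 2 = k)%N ->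
  \sum_m nu m = 1 ->
  k%:R * bary V j (\sum_m nu m *: lattice_pt k V (fun i => b i + (i != m))%N) =
  (b j)%:R + 1 - nu j.
Proof.
move=> bk n1; rewrite (affine_comb _ (bary_affine V j) n1).
have h m : (\sum_i (b i + (i != m)) = k)%N.
  rewrite big_split /= -bk; congr (_ + _)%N.
  have [p [q [pm qm pq]]] := I3_two_others m.
  have mp : m != p by rewrite eq_sym.
  have qp : q != p by rewrite eq_sym.
  by rewrite (sum3 _ mp qm qp) eqxx pm qm.
under eq_bigr => m _ do rewrite bary_lattice_pt ?h//.
rewrite mulr_sumr; under eq_bigr => m _ do rewrite mulrCA [k%:R * _]mulrC mulfVK// natrD mulrDr.
rewrite big_split /= -mulr_suml n1 mul1r -addrA; congr (_ + _).
have -> : 1 - nu j = \sum_(m | m != j) nu m.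
  by move: n1; rewrite (bigD1 j)//= => <-; ring.
rewrite (bigD1 j)//= eqxx mulr0 add0r.
by apply: eq_bigr => m; rewrite eq_sym => ->; rewrite mulr1.
Qed.

Lemma hexd_node (a : 'I_3 -> nat) i x : (\sum_i a i = k)%N ->
  hexd k V (lattice_pt k V a) i x = k%:R * bary V i x - (a i)%:R.
Proof. by move=> ak; rewrite /hexd bary_lattice_pt// mulrBr [_ * (_ / _)]mulrC mulfVK. Qed.

(** Shows that a lattice node in a quadrilateral is the vertex at which the quadrilateral sits:
    integral differences make every weight 0 or at least 1, and [nu i] is the largest. *)
Lemma int_weights (i : 'I_3) (nu : 'I_3 -> R) (a b : 'I_3 -> nat) :
  quad_weights i nu -> (forall m, (b m)%:R + nu m = (a m)%:R) ->
  nu i = 1 /\ forall m, m != i -> nu m = 0.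
Proof.
move=> [n0 n1 ni] h.
have key m : nu m = 0 \/ 1 <= nu m.
  have [le|lt] := leqP (a m) (b m).
    left; apply/eqP; rewrite eq_le n0 andbT.
    by have := h m; move: le; rewrite -(ler_nat R); lra.
  by right; have := h m; move: lt; rewrite -(ler_nat R) -addn1 natrD; lra.
have [j [m [ji mi jm]]] := I3_two_others i.
have ij : i != j by rewrite eq_sym.
have mj : m != j by rewrite eq_sym.
rewrite (sum3 _ ij mi mj) in n1.
have := n0 i; have := n0 j; have := n0 m; have := ni j; have := ni m => ? ? ? ? ?.
have nj : nu j = 0 by case: (key j) => // ?; lra.
have nm : nu m = 0 by case: (key m) => // ?; lra.
split; first by lra.
by move=> n nni; case: (I3_cover n ij mi mj) => e; subst n; rewrite ?nj ?nm// eqxx in nni *.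
Qed.

(** The hexagon inequality within one quadrilateral, [nu'] being the weights of its vertex. For
    [q = i] and [p] different it is the maximality of [nu i]. *)
Lemma weights_diff (i : 'I_3) (nu nu' : 'I_3 -> R) p q :
  quad_weights i nu -> nu' i = 1 -> (forall m, m != i -> nu' m = 0) ->
  (nu p - nu' p) - (nu q - nu' q) <= 1 /\ nu p <= 1.
Proof.
move=> [n0 n1 ni] h1 h0.
have le1 m : nu m <= 1 by rewrite -n1 (bigD1 m)//= lerDl sumr_ge0.
split=> //; have := n0 p; have := n0 q; have := ni p; have := ni q; have := le1 p; have := le1 q.
have [->|pi] := eqVneq p i; have [->|qi] := eqVneq q i; rewrite ?h1 ?(h0 p)// ?(h0 q)//; lra.
Qed.

(** If only the displacement [i] may be negative, [x] lies in the upright sub-triangle having the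
    node as its vertex [i]. The local weights are the displacements, raised by one at [i]. *)
Lemma tcell_up (a : 'I_3 -> nat) i x : (\sum_i a i = k)%N -> (0 < a i)%N ->
  (forall m, m != i -> 0 <= hexd k V (lattice_pt k V a) m x) ->
  (forall m, hexd k V (lattice_pt k V a) m x - hexd k V (lattice_pt k V a) i x <= 1) ->
  tcell k V (lattice_pt k V a) x.
Proof.
set xi := lattice_pt k V a => ak ai hm hi.
pose b m := (a m - (m == i))%N.
have bE m : (b m + (m == i))%N = a m.
  by rewrite /b subnK//; case: eqP => [->|].
have bk : (\sum_i b i + 1 = k)%N.
  rewrite -ak -(eq_bigr _ (fun m _ => bE m)) big_split /=; congr (_ + _)%N.
  by rewrite (bigD1 i)//= eqxx big1// => m /negPf ->.
(* Used twice: for [x], and for the node itself, whose displacements vanish. *)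
have key y : (forall m, m != i -> 0 <= hexd k V xi m y) ->
    (forall m, hexd k V xi m y - hexd k V xi i y <= 1) ->
    quad (fun m => lattice_pt k V (fun j => b j + (j == m))%N) i y.
  move=> h1 h2; rewrite quadE /=.
  pose nu m := hexd k V xi m y + (m == i)%:R.
  have n1 : \sum_m nu m = 1.
    rewrite big_split /= hexd_sum add0r (bigD1 i)//= eqxx big1 ?addr0// => m /negPf ->//.
  exists nu; first split=> //.
  - move=> m; rewrite /nu; have [->|mi] := eqVneq m i; last by rewrite addr0 h1.
    have [j [_ [ji _ _]]] := I3_two_others i.
    by rewrite /= ?mulr0n ?mulr1n; have := h2 j; have := h1 j ji; lra.
  - move=> m; rewrite /nu eqxx; have [->|mi] := eqVneq m i; first by [].
    by rewrite /= ?mulr0n ?mulr1n; have := h2 m; lra.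
  apply: (bary_inj nd) => j; apply: (mulfI kR); rewrite bary_up//.
  by rewrite /nu hexd_node// -(bE j) natrD; ring.
exists (fun m => lattice_pt k V (fun j => b j + (j == m))%N), i; split.
- by left; exists b.
- by apply: key => m; rewrite ?hexd_self// subrr ler01.
- exact: key.
Qed.

(** Mirror image of [tcell_up] in the reflected sub-triangle with vertex [i] at the node. Stepping
    down in the two other coordinates requires them to be positive. *)
Lemma tcell_down (a : 'I_3 -> nat) i x : (\sum_i a i = k)%N ->
  (forall m, m != i -> (0 < a m)%N) ->
  (forall m, m != i -> hexd k V (lattice_pt k V a) m x <= 0) ->
  (forall m, hexd k V (lattice_pt k V a) i x - hexd k V (lattice_pt k V a) m x <= 1) ->
  tcell k V (lattice_pt k V a) x.
Proof.
set xi := lattice_pt k V a => ak ai hm hi.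
pose b m := (a m - (m != i))%N.
have bE m : (b m + (m != i))%N = a m.
  by rewrite /b subnK//; case: eqVneq => [->//|/ai].
have bk : (\sum_i b i + 2 = k)%N.
  rewrite -ak -(eq_bigr _ (fun m _ => bE m)) big_split /=; congr (_ + _)%N.
  have [p [q [pm qm pq]]] := I3_two_others i.
  have mp : i != p by rewrite eq_sym.
  have qp : q != p by rewrite eq_sym.
  by rewrite (sum3 _ mp qm qp) eqxx pm qm.
have key y : (forall m, m != i -> hexd k V xi m y <= 0) ->
    (forall m, hexd k V xi i y - hexd k V xi m y <= 1) ->
    quad (fun m => lattice_pt k V (fun j => b j + (j != m))%N) i y.
  move=> h1 h2; rewrite quadE /=.
  pose nu m := (m == i)%:R - hexd k V xi m y.
  have n1 : \sum_m nu m = 1.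
    rewrite sumrB /= hexd_sum subr0 (bigD1 i)//= eqxx big1 ?addr0// => m /negPf ->//.
  exists nu; first split=> //.
  - move=> m; rewrite /nu; have [->|mi] := eqVneq m i; last first.
      by rewrite /= mulr0n; have := h1 m mi; lra.
    have [j [_ [ji _ _]]] := I3_two_others i.
    by rewrite /= ?mulr0n ?mulr1n; have := h2 j; have := h1 j ji; lra.
  - move=> m; rewrite /nu eqxx; have [->|mi] := eqVneq m i; first by [].
    by rewrite /= ?mulr0n ?mulr1n; have := h2 m; lra.
  apply: (bary_inj nd) => j; apply: (mulfI kR); rewrite bary_down//.
  by rewrite /nu hexd_node// -(bE j) natrD; case: eqVneq => _ /=; ring.
exists (fun m => lattice_pt k V (fun j => b j + (j != m))%N), i; split.
- by right; exists b.
- by apply: key => m; rewrite ?hexd_self// subrr ler01.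
- exact: key.
Qed.

(* The dual cell is the element intersected with a hexagon, the Voronoi cell of
   the node in the triangular lattice of barycentric coordinates. *)
Lemma tcellE xi : nodes k V xi -> tcell k V xi =
  [set x | hull V x /\ forall i m, hexd k V xi i x - hexd k V xi m x <= 1].
Proof.
move=> [a /= ak <-]; apply/seteqP; split => x /=; last first.
  rewrite hullE//= => -[hx hh].
  set d := fun i => hexd k V (lattice_pt k V a) i x in hh.
  have hd i : 0 <= (a i)%:R + d i.
    by rewrite /d hexd_node// addrC subrK mulr_ge0.
  have d0 : \sum_i d i = 0 by exact: hexd_sum.
  (* A negative displacement inside the element forces the node off that edge, so the required
     sub-triangle exists. *)
  have apos i : d i < 0 -> (0 < a i)%N.
    by move=> di; rewrite lt0n; apply/eqP => ai; have := hd i; rewrite ai; lra.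
  (* The displacements sum to zero and their signs select the sub-triangle: with none negative [x]
     is the node and any upright one at it will do; one negative entry gives an upright one, two a
     reflected one. *)
  have [[i di]|nneg] := pselect (exists i, d i < 0); last first.
    have d00 i : d i = 0.
      have dge j : 0 <= d j by rewrite leNgt; apply/negP => dj; apply: nneg; exists j.
      by apply/eqP; move: (psumr_eq0P (fun j _ => dge j) d0) => ->.
    have [i ai] : exists i, (0 < a i)%N.
      apply: contrapT => h; move: k0; rewrite -ak big1// => i _.
      by apply/eqP; rewrite -leqn0 leqNgt; apply/negP => ai; apply: h; exists i.
    by apply: (tcell_up ak ai) => m; rewrite -/(d m) -?/(d i) !d00// subrr.
  have [[j ji dj]|h] := pselect (exists2 j, j != i & d j < 0); last first.
    apply: (tcell_up ak (apos _ di)) => m; last exact: hh.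
    by move=> mi; rewrite leNgt; apply/negP => dm; apply: h; exists m.
  have ij : i != j by rewrite eq_sym.
  have [m [mi mj]] := I3_third ij.
  rewrite (sum3 _ ij mi mj) in d0.
  have hn n : n != m -> d n < 0.
    by move=> nm; case: (I3_cover n ij mi mj) => e; subst n => //; rewrite eqxx in nm.
  apply: (tcell_down ak (i := m)) => n; last exact: hh.
    by move=> nm; apply: apos; exact: hn.
  by move=> nm; apply: ltW; exact: hn.
move=> [S [i [sS]]]; rewrite !quadE /= => -[nu' w' ex'] [nu w ex].
have [_ n1' _] := w'; have [n0 n1 _] := w.
case: sS => -[b /= bk eS]; rewrite -{}eS in ex' ex.
  have h j : (b j)%:R + nu' j = (a j)%:R.
    by rewrite -bary_up// -ex' bary_lattice_pt// [_ * (_ / _)]mulrC mulfVK.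
  have [n1i n0i] := int_weights w' h.
  have hx j : k%:R * bary V j x = (b j)%:R + nu j by rewrite ex bary_up.
  split.
    rewrite hullE//= => j; rewrite -(pmulr_rge0 _ (_ : 0 < k%:R)) ?ltr0n//.
    by rewrite hx addr_ge0.
  move=> p q; rewrite !hexd_node// !hx -!h.
  by have [+ _] := weights_diff p q w n1i n0i; lra.
have h j : (b j)%:R + 1 - nu' j = (a j)%:R.
  by rewrite -bary_down// -ex' bary_lattice_pt// [_ * (_ / _)]mulrC mulfVK.
(* In a reflected sub-triangle the weights lead from the node up to [b + 1], so [a] takes the place
   of the lower lattice point. *)
have h' j : (a j)%:R + nu' j = (b j + 1)%:R :> R by rewrite -h natrD; ring.
have [n1i n0i] := int_weights w' h'.
have hx j : k%:R * bary V j x = (b j)%:R + 1 - nu j by rewrite ex bary_down.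
split.
  rewrite hullE//= => j; rewrite -(pmulr_rge0 _ (_ : 0 < k%:R)) ?ltr0n//.
  rewrite hx; have [_ +] := weights_diff j j w n1i n0i.
  by have : (0 : R) <= (b j)%:R by []; lra.
move=> p q; rewrite !hexd_node// !hx -!h.
by have [+ _] := weights_diff q p w n1i n0i; lra.
Qed.

End OneElement.

End DualCells.

(** * Conforming meshes *)

Section LipschitzDomain.
Context {R : realType}.
Notation pt := (R * R)%type.

Lemma rot90_decomp (e v : pt) : dot e e = 1 ->
  v = dot v e *: e + dot v (rot90 e) *: rot90 e.
Proof.
rewrite /dot /rot90 => e1; apply: ptP; rewrite /= !scaleRE.
  by rewrite -[LHS]mulr1 -e1; ring.
by rewrite -[LHS]mulr1 -e1; ring.
Qed.

(* Just above a frontier point, in the direction of the graph, there are points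
   outside the closure. *)
Lemma interior_closure_lipschitz (Om : set pt) : open Om ->
  lipschitz_boundary Om -> interior (closure Om) `<=` Om.
Proof.
move=> oOm lip x ix; apply: contrapT => nOx.
have fx : frontier Om x.
  split; first exact: (interior_subset ix).
  by move=> /interior_subset.
have [e [gamma [r [L [e1 r0 gl gOm]]]]] := lip x fx.
have g0 : gamma 0 <= 0.
  rewrite leNgt; apply/negP => g0; apply: nOx.
  have := (gOm 0 0); rewrite normr0 !scale0r !addr0 => /(_ r0 r0).
  by case=> _; apply.
have L0 : 0 <= L.
  have := gl 0 1; rewrite sub0r normrN normr1 mulr1; apply: le_trans.
  exact: normr_ge0.
have [d d0 hd] := near_ray (rot90 e) ix.
(* [d] keeps the test point in the closure, [r / 2] keeps its neighbourhood inside the chart. *)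
pose t := Num.min d (r / 2).
have t0 : 0 < t by rewrite lt_min d0 divr_gt0.
have tr : t <= r / 2 by rewrite ge_min lexx orbT.
have : closure Om (x + t *: rot90 e).
  by apply: hd; rewrite gtr0_norm// ge_min lexx.
pose s (y : pt) := dot (y - x) e; pose u (y : pt) := dot (y - x) (rot90 e).
have sa : affine s.
  by move=> y; rewrite /s /alin /dot /=; ring.
have ua : affine u.
  by move=> y; rewrite /u /alin /dot /=; ring.
set z := x + _; have sz : s z = 0.
  by rewrite /s /z addrC addKr /dot /rot90 /= !scaleRE; ring.
have uz : u z = t.
  rewrite /u /z addrC addKr dotC dotZr -[RHS]mulr1 -e1 /dot /rot90 /=; ring.
have near_z : \forall y \near z, gamma (s y) <= u y /\ `|s y| < r /\ `|u y| < r.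
  (* Positivity of [c1] and [c2] says that [u y] exceeds [L * |s y| + t / 2], which puts [y] above
     the graph. Both equal [t / 2] at [z]. *)
  have c1 : affine (fun y => t / 2 - (L * s y) - (t - u y)).
    apply: affineB; last by apply: affineB => //; exact: affine_cst.
    by apply: affineB; [exact: affine_cst|exact: affineZ].
  have c2 : affine (fun y => t / 2 - (- L * s y) - (t - u y)).
    apply: affineB; last by apply: affineB => //; exact: affine_cst.
    by apply: affineB; [exact: affine_cst|exact: affineZ].
  have c3 : affine (fun y => r - s y) by apply: affineB => //; exact: affine_cst.
  have c4 : affine (fun y => r + s y) by apply: affineD => //; exact: affine_cst.
  have c5 : affine (fun y => r - u y) by apply: affineB => //; exact: affine_cst.
  have c6 : affine (fun y => r + u y) by apply: affineD => //; exact: affine_cst.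
  have n1 := @near_gt0 _ _ z (affine_continuous c1).
  have n2 := @near_gt0 _ _ z (affine_continuous c2).
  have n3 := @near_gt0 _ _ z (affine_continuous c3).
  have n4 := @near_gt0 _ _ z (affine_continuous c4).
  have n5 := @near_gt0 _ _ z (affine_continuous c5).
  have n6 := @near_gt0 _ _ z (affine_continuous c6).
  rewrite !sz !uz in n1 n2 n3 n4 n5 n6.
  have {}n1 := n1 ltac:(lra). have {}n2 := n2 ltac:(lra).
  have {}n3 := n3 ltac:(lra). have {}n4 := n4 ltac:(lra).
  have {}n5 := n5 ltac:(lra). have {}n6 := n6 ltac:(lra).
  apply: filterS2 (filterI n1 n2) (filterI n3 (filterI n4 (filterI n5 n6))) =>
    y [h1 h2] [h3 [h4 [h5 h6]]].
  split; last by rewrite !ltr_norml; split; apply/andP; split; lra.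
  have h7 : gamma (s y) <= L * `|s y|.
    have := gl (s y) 0; rewrite subr0; have := ler_norm (gamma (s y) - gamma 0); lra.
  have : L * `|s y| <= u y by have [?|?] := ger0P (s y); lra.
  lra.
move=> /(_ _ near_z) [y [Oy [h1 [h2 h3]]]].
have := (gOm (s y) (u y) h2 h3); rewrite -addrA -rot90_decomp// addrC subrK.
by case=> /(_ Oy); rewrite ltNge h1.
Qed.

End LipschitzDomain.

(** * Adjacent elements *)

Section Mesh.
Context {R : realType}.
Notation pt := (R * R)%type.

Lemma near_setI (x : pt) (P Q : set pt) : nbhs x P -> nbhs x Q -> nbhs x (P `&` Q).
Proof. exact: filterI. Qed.

Variables (Om : set pt) (J : finType) (V : J -> 'I_3 -> pt).
Hypothesis tri : triangulation Om V.

Let nd j : Defs.nondegenerate (V j).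
Proof. by have [_ + _] := tri. Qed.

(** A single form for the nonempty intersections: one permutation matches the coordinates on all of
    the intersection, one coordinate [i3] vanishes there, and with each point the smallest face of
    the element through it is shared. *)
Lemma conforming j j' : j != j' -> hull (V j) `&` hull (V j') !=set0 ->
  exists (s : {perm 'I_3}) (i3 : 'I_3),
    forall x, hull (V j) x -> hull (V j') x ->
    [/\ forall i, bary (V j) i x = bary (V j') (s i) x,
        bary (V j) i3 x = 0 &
        forall y, hull (V j) y ->
          (forall i, bary (V j) i x = 0 -> bary (V j) i y = 0) -> hull (V j') y].
Proof.
move=> jj' ne; have [_ _ /(_ j j' jj')] := tri.
case=> [e|[i [i' [ee e]]]|[i1 [i2 [i1' [i2' [i12 e1 e2 e]]]]]].
- by rewrite e in ne; case: ne.
- have [p [q [pi qi pq]]] := I3_two_others i.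
  (* At the common vertex all that matters about the permutation is that it sends [i] to [i']. *)
  exists (tperm i i'), p => x hx hx'.
  have {hx'} -> : x = V j i.
    by have : (hull (V j) `&` hull (V j')) x by []; rewrite e.
  split=> [n||y hy sy].
  + rewrite bary_vertex// ee bary_vertex//; congr (_ %:R).
    by rewrite -{2}(tpermL i i') (inj_eq perm_inj).
  + by rewrite bary_vertex// (negPf pi).
  + have -> : y = V j i; last first.
      have : (hull (V j) `&` hull (V j')) (V j i) by rewrite e.
      by case.
    have z n : n != i -> bary (V j) n y = 0.
      by move=> ni; apply: sy; rewrite bary_vertex// (negPf ni).
    apply: (bary_inj (nd j)) => n; have [->|ni] := eqVneq n i; last first.
      by rewrite z// bary_vertex// (negPf ni).
    rewrite bary_vertex// eqxx -(bary_sum (V j) y) (bigD1 i)//= big1 ?addr0//.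
- have i12' : i1' != i2'.
    apply/eqP => h; have : V j i1 = V j i2 by rewrite e1 e2 h.
    move=> /(congr1 (bary (V j) i1)); rewrite !bary_vertex// eqxx (negPf i12).
    by move=> /eqP; rewrite oner_eq0.
  have [i3 [i31 i32]] := I3_third i12.
  pose t := tperm i1 i1'.
  (* The second transposition places the image of [i2] and leaves [i1'] in its place. *)
  pose s := (t * tperm (t i2) i2')%g.
  have s1 : s i1 = i1'.
    rewrite /s permM tpermL tpermD//; last by rewrite eq_sym.
    by rewrite -[X in _ != X](tpermL i1 i1') (inj_eq perm_inj) eq_sym.
  have s2 : s i2 = i2' by rewrite /s permM tpermL.
  have seg (x : pt) (t0 : R) : x = (1 - t0) *: V j i1 + t0 *: V j i2 ->
      (forall n, bary (V j) n x = (1 - t0) * (n == i1)%:R + t0 * (n == i2)%:R) /\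
      (forall n, bary (V j') n x = (1 - t0) * (n == i1')%:R + t0 * (n == i2')%:R).
    move=> ->; split=> n.
      have := affine_ray (V j i1) (V j i2 - V j i1) t0 (bary_affine (V j) n).
      rewrite -affine_sub; last exact: bary_affine.
      rewrite !bary_vertex//.
      have -> : V j i1 + t0 *: (V j i2 - V j i1) = (1 - t0) *: V j i1 + t0 *: V j i2.
        by apply: ptP; rewrite /= !scaleRE; ring.
      by move=> ->; ring.
    rewrite e1 e2.
    have := affine_ray (V j' i1') (V j' i2' - V j' i1') t0 (bary_affine (V j') n).
    rewrite -affine_sub; last exact: bary_affine.
    rewrite !bary_vertex//.
    have -> : V j' i1' + t0 *: (V j' i2' - V j' i1') = (1 - t0) *: V j' i1' + t0 *: V j' i2'.
      by apply: ptP; rewrite /= !scaleRE; ring.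
    by move=> ->; ring.
  exists s, i3 => x hx hx'.
  have : (hull (V j) `&` hull (V j')) x by [].
  rewrite e => -[t0 t01 xE]; have [b1 b2] := seg x t0 xE.
  split=> [n||y hy sy].
  + by rewrite b1 b2 -s1 -s2 !(inj_eq perm_inj).
  + by rewrite b1 (negPf i31) (negPf i32) !mulr0 addr0.
  + have z : bary (V j) i3 y = 0.
      by apply: sy; rewrite b1 (negPf i31) (negPf i32) !mulr0 addr0.
    have : segment (V j i1) (V j i2) y; last by rewrite -e => -[].
    have s1' : bary (V j) i1 y + bary (V j) i2 y = 1.
      by rewrite -(bary_sum (V j) y) (sum3 _ i12 i31 i32) z addr0.
    rewrite hullE//= in hy; exists (bary (V j) i2 y).
      by have h1 := hy i1; have h2 := hy i2; apply/andP; split; lra.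
    rewrite {1}(bary_comb y (nd j)) (sum3 _ i12 i31 i32) z scale0r addr0.
    by congr (_ *: _ + _); lra.
Qed.

Lemma interior_disjoint j j' x :
  (forall i, 0 < bary (V j) i x) -> hull (V j') x -> j' = j.
Proof.
move=> ix hx'; apply/eqP/negPn/negP => jj'.
have hx : hull (V j) x by rewrite hullE//= => i; exact: ltW.
rewrite eq_sym in jj'; have [|s [i3 h]] := conforming jj'; first by exists x.
by have [_ e _] := h x hx hx'; have := ix i3; rewrite e ltxx.
Qed.

Lemma face_sub j j' x y : hull (V j) x -> hull (V j') x -> hull (V j) y ->
  (forall i, bary (V j) i x = 0 -> bary (V j) i y = 0) -> hull (V j') y.
Proof.
have [->//|jj'] := eqVneq j j'.
move=> hx hx' hy sy; have [|s [i3 h]] := conforming jj'; first by exists x.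
by have [_ _] := h x hx hx'; apply.
Qed.

Lemma bary_match j j' x0 : hull (V j) x0 -> hull (V j') x0 ->
  exists s : {perm 'I_3}, forall x, hull (V j) x -> hull (V j') x ->
    forall i, bary (V j) i x = bary (V j') (s i) x.
Proof.
move=> hx hx'; have [<-|jj'] := eqVneq j j'.
  by exists 1%g => x _ _ i; rewrite perm1.
have [|s [i3 h]] := conforming jj'; first by exists x0.
by exists s => x h1 h2 i; have [e _ _] := h x h1 h2; exact: e.
Qed.

(** The open edge opposite to the vertex [i]. *)
Definition on_edge j i (x : pt) := bary (V j) i x = 0 /\
  forall m, m != i -> 0 < bary (V j) m x.

Lemma on_edge_hull j i x : on_edge j i x -> hull (V j) x.
Proof.
move=> [z p]; rewrite hullE//= => m.
by have [->|mi] := eqVneq m i; [rewrite z|exact: ltW (p m mi)].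
Qed.

Lemma near_on_edge j i x : on_edge j i x ->
  \forall y \near x, forall m, m != i -> 0 < bary (V j) m y.
Proof.
move=> [_ p]; apply: (near_all3 (P := fun m y => m != i -> 0 < bary (V j) m y)) => m.
have [->|mi] := eqVneq m i; first by apply: filterE => y.
by apply: filterS (near_bary_gt0 (p m mi)).
Qed.

Lemma near_edge_hull j i x : on_edge j i x ->
  \forall y \near x, hull (V j) y <-> 0 <= bary (V j) i y.
Proof.
move=> /near_on_edge; apply: filterS => y h; rewrite hullE//=; split=> [|yi m]; first exact.
by have [->//|/h/ltW] := eqVneq m i.
Qed.

(** The two affine functions vanish at the same two vertices, so they are proportional; a positive
    factor would make the elements overlap. *)
Lemma opposite_edge j j' i x : j != j' -> on_edge j i x -> hull (V j') x ->
  exists i' c, [/\ on_edge j' i' x, c < 0 &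
    forall y, bary (V j') i' y = c * bary (V j) i y].
Proof.
move=> jj' ex hx'; have hx := on_edge_hull ex.
have [|s [i3 h]] := conforming jj'; first by exists x.
have [hs _ hf] := h x hx hx'.
have ex' : on_edge j' (s i) x.
  split=> [|m mi]; first by rewrite -hs ex.1.
  rewrite -(permKV s m) -hs; apply: ex.2.
  by apply: contra mi => /eqP <-; rewrite permKV.
(* Both ends of the edge are shared, as they lie in the smallest face through [x]. *)
have vm m : m != i -> bary (V j') (s i) (V j m) = 0.
  move=> mi; have hm : hull (V j) (V j m) by rewrite hullE//= => n; rewrite bary_vertex.
  have hm' : hull (V j') (V j m).
    apply: hf => // n n0; rewrite bary_vertex//.
    case: eqVneq => // nm; rewrite nm in n0.
    by have := ex.2 m mi; rewrite n0 ltxx.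
  have [<- _ _] := h _ hm hm'; rewrite bary_vertex// eq_sym (negPf mi)//.
pose c := bary (V j') (s i) (V j i).
have cE y : bary (V j') (s i) y = c * bary (V j) i y.
  rewrite {1}(bary_comb y (nd j)) affine_comb ?bary_sum//; last exact: bary_affine.
  rewrite (bigD1 i)//= big1 ?addr0 => [|m mi]; first by rewrite mulrC.
  by rewrite vm// mulr0.
exists (s i), c; split => //.
rewrite ltNge; apply/negP => c0.
have {c0}c0 : 0 < c.
  rewrite lt_neqAle c0 andbT; apply/eqP => c00.
  by have := cE (V j' (s i)); rewrite bary_vertex// eqxx -c00 mul0r => /eqP; rewrite oner_eq0.
have nn := near_setI (near_on_edge ex) (near_on_edge ex').
have [y [h1 h2] y0] := near_pos_side (bary_affine _ _) (alin_bary i (nd j)) ex.1 nn.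
have : j' = j; last by move/eqP; rewrite eq_sym (negPf jj').
apply: (@interior_disjoint _ _ y) => [m|].
  by have [->//|mi] := eqVneq m i; exact: h1.
rewrite hullE//= => m; have [->|mi] := eqVneq m (s i); last exact: ltW (h2 m mi).
by rewrite cE mulr_ge0// ltW.
Qed.

Lemma near_opposite_hull j j' i x : j != j' -> on_edge j i x -> hull (V j') x ->
  \forall y \near x, hull (V j') y <-> bary (V j) i y <= 0.
Proof.
move=> jj' ex hx'; have [i' [c [ex' c0 cE]]] := opposite_edge jj' ex hx'.
by apply: filterS (near_edge_hull ex') => y; rewrite cE nmulr_rge0.
Qed.

(** Two further elements at the edge would both fill its other side near [x] and overlap there. *)
Lemma neighbour_unique j j1 j2 i x : j != j1 -> j != j2 -> on_edge j i x ->
  hull (V j1) x -> hull (V j2) x -> j1 = j2.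
Proof.
move=> jj1 jj2 ex h1 h2.
have [i' [c [ex' c0 cE]]] := opposite_edge jj1 ex h1.
have nn := near_setI (near_on_edge ex') (near_opposite_hull jj2 ex h2).
have [y [a1 a2] y0] := near_neg_side (bary_affine _ _) (alin_bary i (nd j)) ex.1 nn.
apply/esym; apply: (@interior_disjoint _ _ y) => [m|].
  have [->|mi] := eqVneq m i'; last exact: a1.
  by rewrite cE nmulr_rgt0.
by apply/a2; exact: ltW.
Qed.

Lemma near_union j j' i x : j != j' -> on_edge j i x -> hull (V j') x ->
  \forall y \near x, hull (V j) y \/ hull (V j') y.
Proof.
move=> jj' ex hx'.
apply: filterS2 (near_edge_hull ex) (near_opposite_hull jj' ex hx') => y h1 h2.
by have [/ltW|] := ltP 0 (bary (V j) i y) => hy; [left; apply/h1|right; apply/h2].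
Qed.

Lemma hull_closure j : hull (V j) `<=` closure Om.
Proof. by have [-> _ _] := tri; move=> x hx; exists j. Qed.

Hypothesis oOm : open Om.
Hypothesis rOm : interior (closure Om) `<=` Om.

Lemma interior_hull_Om j x : (forall i, 0 < bary (V j) i x) -> Om x.
Proof.
move=> ix; apply: rOm; apply: filterS (@hull_closure j) _.
have : interior (hull (V j)) x by rewrite interior_hullE.
by [].
Qed.

Lemma inner_edge_Om j j' i x : j != j' -> on_edge j i x -> hull (V j') x -> Om x.
Proof.
move=> jj' ex hx'; apply: rOm.
apply: filterS (near_union jj' ex hx') => y [|]; exact: hull_closure.
Qed.

(** If only one element met the edge, points of [Om] just beyond it would lie in no element. A
    single neighbour serves the whole closed edge. *)
Lemma neighbour j i xi : Om xi -> hull (V j) xi -> bary (V j) i xi = 0 ->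
  exists2 j', j != j' & forall x, hull (V j) x -> bary (V j) i x = 0 -> hull (V j') x.
Proof.
move=> Oxi hxi zxi.
have [p [q [pi qi pq]]] := I3_two_others i.
pose m := midpoint (V j p) (V j q).
have nOm : \forall y \near xi, Om y by exact: open_nbhs_nbhs.
have [e e0 he] := near_ray (m - xi) nOm.
pose t := Num.min e 1.
have t0 : 0 < t by rewrite lt_min e0 ltr01.
have t1 : t <= 1 by rewrite ge_min lexx orbT.
(* The node may be an end of the edge; a small step towards the midpoint reaches the open edge
   without leaving [Om]. *)
pose y := xi + t *: (m - xi).
have Oy : Om y by apply: he; rewrite gtr0_norm// ge_min lexx.
have ym n : bary (V j) n y = (1 - t) * bary (V j) n xi + t * (2^-1 * ((n == p)%:R + (n == q)%:R)).
  rewrite /y affine_ray; last exact: bary_affine.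
  rewrite -affine_sub; last exact: bary_affine.
  have -> : bary (V j) n m = 2^-1 * ((n == p)%:R + (n == q)%:R).
    rewrite -!(bary_vertex _ _ (nd j)).
    by rewrite (bary_affine (V j) n m) (bary_affine (V j) n (V j p))
      (bary_affine (V j) n (V j q)) /m /midpoint /dot /= !scaleRE; field.
  by ring.
have hxi' n : 0 <= bary (V j) n xi by move: hxi; rewrite hullE.
have ey : on_edge j i y.
  split=> [|n ni].
    by rewrite ym zxi eq_sym (negPf pi) eq_sym (negPf qi) /=; ring.
  have ip : i != p by rewrite eq_sym.
  have : (2^-1 : R) <= 2^-1 * ((n == p)%:R + (n == q)%:R).
    case: (I3_cover n ip qi _) => [|E|E|E]; first by rewrite eq_sym.
    - by rewrite E eqxx in ni.
    - by rewrite E eqxx (negPf pq) addr0 mulr1.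
    - by rewrite E eqxx eq_sym (negPf pq) add0r mulr1.
  rewrite ym => h; apply: ltr_wpDl; first by rewrite mulr_ge0// subr_ge0.
  by rewrite mulr_gt0//; apply: lt_le_trans h; rewrite invr_gt0.
have [[j' jj' hy']|none] := pselect (exists2 j', j != j' & hull (V j') y).
  exists j' => // x hx zx; apply: (face_sub (on_edge_hull ey) hy' hx) => n.
  by have [->//|ni] := eqVneq n i; have := ey.2 n ni; move=> /[swap] ->; rewrite ltxx.
have nh : \forall z \near y, forall j', j != j' -> ~ hull (V j') z.
  apply: (@filter_forall _ _ (fun j' z => j != j' -> ~ hull (V j') z) _
    (nbhs_filter y)) => j'; have [E|jj'] := eqVneq j j'.
    by apply: filterE.
  have : open (~` hull (V j')) by apply: closed_openC; exact: closed_hull.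
  move=> o; have : nbhs y (~` hull (V j')).
    by apply: open_nbhs_nbhs; split=> // hy; apply: none; exists j'.
  by apply: filterS => z hz _.
have nOy : \forall z \near y, Om z by exact: open_nbhs_nbhs.
have [z [z1 z2] z0] := near_neg_side (bary_affine _ _) (alin_bary i (nd j)) ey.1 (near_setI nh nOy).
have : closure Om z by exact: subset_closure.
have [-> _ _] := tri => -[j' _ hz].
have [E|jj'] := eqVneq j j'; last by case: (z1 j').
by move: hz; rewrite -E hullE//= => /(_ i); rewrite leNgt z0.
Qed.

Lemma not_on_edge_vertex j x : hull (V j) x -> ~ (forall i, 0 < bary (V j) i x) ->
  (exists i, on_edge j i x) \/ (exists i, x = V j i).
Proof.
rewrite hullE//= => hx nx.
have [i zi] : exists i, bary (V j) i x = 0.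
  apply: contrapT => h; apply: nx => i; rewrite lt_neqAle hx andbT.
  by apply/eqP => e; apply: h; exists i.
have [p [q [pi qi pq]]] := I3_two_others i.
have ip : i != p by rewrite eq_sym.
have qp : q != p by rewrite eq_sym.
have vert r r' : (forall n, [\/ n = i, n = r | n = r']) -> r != i -> r != r' -> r' != i ->
    bary (V j) r x = 0 -> x = V j r'.
  move=> cov ri rr' r'i zr; have z n : n != r' -> bary (V j) n x = 0.
    by move=> nr; case: (cov n) => E; subst n => //; rewrite eqxx in nr.
  apply: (bary_inj (nd j)) => n; have [->|nr] := eqVneq n r'; last first.
    by rewrite z// bary_vertex// (negPf nr).
  by rewrite bary_vertex// eqxx -(bary_sum (V j) x) (bigD1 r')//= big1 ?addr0.
have cov n := I3_cover n ip qi qp.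
have [zp|np] := eqVneq (bary (V j) p x) 0.
  by right; exists q; apply: (vert p q) => //.
have [zq|nq] := eqVneq (bary (V j) q x) 0.
  right; exists p; apply: (vert q p) => //.
  by move=> n; case: (cov n) => ?; [exact: Or31|exact: Or33|exact: Or32].
left; exists i; split=> // n ni; rewrite lt_neqAle hx andbT eq_sym.
by case: (cov n) => E; subst n => //; rewrite eqxx in ni.
Qed.

(** The last hypothesis says that [xi] lies in the smallest face through [x]. That face may be the
    element, an edge, which then has elements on both sides, or the vertex [xi] itself; in each case
    [x] lies in [Om]. This yields the zero boundary values of the test function. *)
Lemma frontier_support j xi x : Om xi -> hull (V j) xi -> hull (V j) x ->
  frontier Om x -> (forall i, bary (V j) i x = 0 -> bary (V j) i xi = 0) -> False.
Proof.
move=> Oxi hxi hx fx sx.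
have nOx : ~ Om x.
  by move=> Ox; apply: fx.2; rewrite (_ : interior Om = Om)//; exact/interior_id.
have [ix|nx] := pselect (forall i, 0 < bary (V j) i x).
  by apply: nOx; exact: interior_hull_Om ix.
have [[i ex]|[i xE]] := not_on_edge_vertex hx nx.
  have [j' jj' hj'] := neighbour Oxi hxi (sx i ex.1).
  by apply: nOx; apply: (inner_edge_Om jj' ex); apply: hj' => //; exact: ex.1.
have z n : n != i -> bary (V j) n xi = 0.
  by move=> ni; apply: sx; rewrite xE bary_vertex// (negPf ni).
apply: nOx; suff -> : x = xi by [].
rewrite xE; apply: (bary_inj (nd j)) => n; have [->|ni] := eqVneq n i; last first.
  by rewrite z// bary_vertex// (negPf ni).
by rewrite bary_vertex// eqxx -(bary_sum (V j) xi) (bigD1 i)//= big1 ?addr0.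
Qed.

End Mesh.

(** * The hexagon of a node and the boundary of its dual cell *)

Section HexagonSpecial.
Context {R : realType}.
Notation pt := (R * R)%type.
Variables (k : nat) (V : 'I_3 -> pt) (xi : pt).
Hypothesis k0 : (0 < k)%N.
Hypothesis nd : Defs.nondegenerate V.
Local Notation d := (hexd k V xi).

(* Contains the corners of the dual cell and the points where its boundary
   crosses the edges of the element through xi. *)
Definition special : set pt :=
  [set x | forall i, exists n : 'I_13, 6 * d i x = n%:R - 6].

(** Why sixths from -1 to 1: two sides of the hexagon, prolonged, meet at displacements that are
    permutations of (2/3, -1/3, -1/3), (1/3, 1/3, -2/3) or (1, 0, -1), and an edge through the node
    meets them at permutations of (1/2, -1/2, 0) or (1, 0, -1). *)
Lemma finite_special : finite_set special.
Proof.
pose F (g : {ffun 'I_3 -> 'I_13}) : pt :=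
  \sum_i (bary V i xi + ((g i)%:R - 6) / (6 * k%:R)) *: V i.
apply: (@sub_finite_set _ _ (F @` setT)); last first.
  by apply: finite_image; exact: finite_finset.
move=> x /= /choice[g hg]; exists [ffun i => g i] => //.
rewrite /F [RHS](bary_comb x nd); apply: eq_bigr => i _; congr (_ *: _).
have kR : (k%:R : R) != 0 by rewrite pnatr_eq0 -lt0n.
by rewrite ffunE -hg /hexd; field.
Qed.

Lemma special_of3 x p q r (a b c : 'I_13) : p != q -> r != p -> r != q ->
  6 * d p x = a%:R - 6 -> 6 * d q x = b%:R - 6 -> 6 * d r x = c%:R - 6 ->
  special x.
Proof.
move=> pq rp rq ha hb hc n; case: (I3_cover n pq rp rq) => ->;
  by [exists a|exists b|exists c].
Qed.

(** Together with the zero sum, the two equations determine all displacements: halves if [i] is the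
    third index, units if it is [p] or [q]. *)
Lemma special_edge x i p q : d i x = 0 -> p != q -> d p x - d q x = 1 -> special x.
Proof.
move=> di pq e.
have := hexd_sum k V xi x.
have qp : q != p by rewrite eq_sym.
have [E|ip] := eqVneq p i.
  rewrite -E in di.
  have [r [rp rq]] := I3_third pq.
  rewrite (sum3 _ pq rp rq) => s.
  apply: (@special_of3 x p q r (inord 6) (inord 0) (inord 12)) => //;
    rewrite inordK//; lra.
have [E|iq] := eqVneq q i.
  rewrite -E in di.
  have [r [rp rq]] := I3_third pq.
  rewrite (sum3 _ pq rp rq) => s.
  apply: (@special_of3 x p q r (inord 12) (inord 6) (inord 0)) => //;
    rewrite inordK//; lra.
rewrite eq_sym in ip; rewrite eq_sym in iq.
rewrite (sum3 _ pq ip iq) => s.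
apply: (@special_of3 x p q i (inord 9) (inord 3) (inord 6)) => //;
  rewrite inordK//; lra.
Qed.

(** Two sides and the zero sum determine the displacements. Opposite sides are parallel, which is
    the contradictory case. *)
Lemma special_corner x p q p' q' : p != q -> p' != q' -> (p, q) != (p', q') ->
  d p x - d q x = 1 -> d p' x - d q' x = 1 -> special x.
Proof.
move=> pq pq' ne e e'.
have := hexd_sum k V xi x.
have qp : q != p by rewrite eq_sym.
have [r [rp rq]] := I3_third pq.
rewrite (sum3 _ pq rp rq) => s.
have [P|P|P] := I3_cover p' pq rp rq; have [Q|Q|Q] := I3_cover q' pq rp rq;
  subst p' q'; rewrite ?eqxx// in ne pq'.
- apply: (@special_of3 x p q r (inord 10) (inord 4) (inord 4)) => //;
    rewrite inordK//; lra.
- by exfalso; lra.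
- apply: (@special_of3 x p q r (inord 12) (inord 6) (inord 0)) => //;
    rewrite inordK//; lra.
- apply: (@special_of3 x p q r (inord 6) (inord 0) (inord 12)) => //;
    rewrite inordK//; lra.
- apply: (@special_of3 x p q r (inord 8) (inord 2) (inord 8)) => //;
    rewrite inordK//; lra.
Qed.

Lemma nodes_bary i : nodes k V xi -> bary V i xi = 0 \/ 1 <= k%:R * bary V i xi.
Proof.
move=> [a /= ak <-]; rewrite bary_lattice_pt//.
have kR : (k%:R : R) != 0 by rewrite pnatr_eq0 -lt0n.
case: (posnP (a i)) => [->|ai]; first by left; rewrite mul0r.
by right; rewrite mulrC mulfVK// ler1n.
Qed.

(** A node off the edge is at least one lattice step away, so [d i <= -1] at [x]; the hexagon then
    makes the other displacements nonpositive, against the zero sum. *)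
Lemma tcell_edge x i : nodes k V xi -> tcell k V xi x -> bary V i x = 0 ->
  bary V i xi = 0.
Proof.
move=> nx tx zx; case: (nodes_bary i nx) => // h; exfalso.
move: tx; rewrite tcellE//= => -[hx hd].
have di : d i x <= - 1 by rewrite /hexd zx sub0r mulrN; lra.
have [p [q [pi qi pq]]] := I3_two_others i.
have ip : i != p by rewrite eq_sym.
have qp : q != p by rewrite eq_sym.
have := hexd_sum k V xi x; rewrite (sum3 _ ip qi qp).
have := hd p i; have := hd q i; lra.
Qed.

Lemma strict_tcell_near x : nodes k V xi ->
  (forall p q, p != q -> d p x - d q x < 1) ->
  \forall y \near x, hull V y -> tcell k V xi y.
Proof.
move=> nx h.
have : \forall y \near x, forall p q, d p y - d q y <= 1.
  apply: near_all3 => p; apply: near_all3 => q.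
  have [->|pq] := eqVneq p q; first by apply: filterE => y; rewrite subrr.
  have a : affine (fun y => 1 - (d p y - d q y)).
    by apply: affineB; [exact: affine_cst|apply: affineB; exact: hexd_affine].
  have := near_gt0 (affine_continuous a) (x := x); rewrite subr_gt0 => /(_ (h p q pq)).
  by apply: filterS => y; lra.
by apply: filterS => y hy hh; rewrite tcellE.
Qed.

(** The hexagon is where all of these are nonnegative. Ordered pairs of distinct indices give its
    six sides, equal indices the constant 1. *)
Definition hexc (pq : 'I_3 * 'I_3) (x : pt) : R := 1 - (d pq.1 x - d pq.2 x).

Lemma hexc_affine pq : affine (hexc pq).
Proof. by apply: affineB; [exact: affine_cst|apply: affineB; exact: hexd_affine]. Qed.

Lemma hexc_nonconst p q : p != q -> alin (hexc (p, q)) != 0.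
Proof.
move=> pq; apply/eqP => e.
have [r [rp rq]] := I3_third pq.
have := affine_sub (V q) (V p) (hexc_affine (p, q)).
rewrite e /hexc /hexd /= !bary_vertex// !eqxx (negPf pq) eq_sym (negPf pq).
rewrite /dot /= !mul0r addr0.
have : (0 : R) < k%:R by rewrite ltr0n.
lra.
Qed.

Lemma closed_tcell : nodes k V xi -> closed (tcell k V xi).
Proof.
move=> nx; rewrite tcellE//.
rewrite (_ : mkset _ = hull V `&` \bigcap_pq [set x | 0 <= hexc pq x]).
  apply: closedI; first exact: closed_hull.
  by apply: closed_bigI => pq _; apply: affine_ge0_closed; exact: hexc_affine.
apply/seteqP; split => x /= [hx hd]; split => //.
  by move=> [p q] _; rewrite /hexc /= subr_ge0.
by move=> p q; have := hd (p, q) I; rewrite /hexc /= subr_ge0.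
Qed.

Lemma dual_edgeE x : nodes k V xi -> dual_edge k V xi x <->
  [/\ forall i, 0 < bary V i x, forall p q, 0 <= hexc (p, q) x &
      exists p q, p != q /\ hexc (p, q) x = 0].
Proof.
move=> nx; rewrite /dual_edge /setI /= interior_hullE//=; split.
  move=> [[cx ix] hx].
  have tx : tcell k V xi x.
    by move: cx; rewrite -((closure_id _).1 (closed_tcell nx)).
  move: (tx); rewrite tcellE//= => -[_ hd].
  split=> // [p q|]; first by rewrite /hexc /= subr_ge0.
  apply: contrapT => ne; apply: ix.
  have st : \forall y \near x, hull V y -> tcell k V xi y.
    apply: strict_tcell_near => // p q pq; rewrite lt_neqAle hd andbT.
    by apply/eqP => e; apply: ne; exists p, q; rewrite /hexc /= e subrr.
  have ih : \forall y \near x, hull V y.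
    have : interior (hull V) x by rewrite interior_hullE.
    by [].
  by apply: filterS2 st ih => y; apply.
move=> [hx hc [p [q [pq e]]]]; split=> //.
have hull_x : hull V x by rewrite hullE//= => i; exact: ltW.
split.
  apply: subset_closure; rewrite tcellE//; split=> // i m.
  by have := hc i m; rewrite /hexc /= subr_ge0.
move=> ix.
have [y ty y0] := near_neg_side (hexc_affine (p, q)) (hexc_nonconst pq) e ix.
move: ty; rewrite tcellE//= => -[_ /(_ p q)].
by move: y0; rewrite /hexc /=; lra.
Qed.

(** Off the special points a single constraint is tight, and the others persist near [x], so the
    cell is locally the half-plane of that side. *)
Lemma onormal_tcell x p q : nodes k V xi ->
  (forall i, 0 < bary V i x) -> (forall p q, 0 <= hexc (p, q) x) ->
  p != q -> hexc (p, q) x = 0 -> ~ special x ->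
  onormal (tcell k V xi) x =
    - ((vlen (alin (hexc (p, q))))^-1 *: alin (hexc (p, q))).
Proof.
move=> nx hx hc pq e nsp.
apply: onormal_halfplane => //; [exact: hexc_affine|exact: hexc_nonconst|].
have ih : \forall y \near x, hull V y.
  have : interior (hull V) x by rewrite interior_hullE.
  by [].
have hn : \forall y \near x, forall p' q', (p', q') != (p, q) -> 0 <= hexc (p', q') y.
  apply: (near_all3 (P := fun p' y => forall q', (p', q') != (p, q) -> 0 <= hexc (p', q') y)) => p'.
  apply: (near_all3 (P := fun q' y => (p', q') != (p, q) -> 0 <= hexc (p', q') y)) => q'.
  have [E|ne] := eqVneq (p', q') (p, q); first by apply: filterE.
  have [E|p'q'] := eqVneq p' q'.
    by apply: filterE => y _; rewrite /hexc /= E; lra.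
  have lt : 0 < hexc (p', q') x.
    rewrite lt_neqAle hc andbT; apply/eqP => e'; apply: nsp.
    apply: (special_corner pq p'q').
    - by rewrite eq_sym.
    - by move: e; rewrite /hexc /=; lra.
    - by move: e'; rewrite /hexc /=; lra.
  apply: filterS (near_gt0 (affine_continuous (hexc_affine (p', q'))) lt) => y h _.
  exact: ltW.
apply: filterS2 ih hn => y hy hny; rewrite tcellE//=; split.
  by move=> [_ /(_ p q)]; rewrite /hexc /= subr_ge0.
move=> h; split=> // i m; have [[-> ->]|ne] := eqVneq (i, m) (p, q).
  by move: h; rewrite /hexc /= subr_ge0.
by have := hny _ _ ne; rewrite /hexc /= subr_ge0.
Qed.

End HexagonSpecial.

(** * Control volumes *)

Section ControlVolume.
Context {R : realType}.
Notation pt := (R * R)%type.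
Variables (k : nat) (Om : set pt) (J : finType) (V : J -> 'I_3 -> pt) (xi : pt).
Hypothesis k0 : (0 < k)%N.
Hypothesis tri : triangulation Om V.
Hypothesis oOm : open Om.
Hypothesis rOm : interior (closure Om) `<=` Om.
Hypothesis Oxi : Om xi.

Let nd j : Defs.nondegenerate (V j).
Proof. by have [_ + _] := tri. Qed.

Local Notation C := (control_volume k V xi).

Lemma tcell_hull j x : nodes k (V j) xi -> tcell k (V j) xi x -> hull (V j) x.
Proof. by move=> nx; rewrite tcellE// => -[]. Qed.

(** On a shared face the barycentric coordinates agree up to a permutation, so they remain multiples
    of [1 / k]. *)
Lemma node_transfer j j' : nodes k (V j) xi -> hull (V j') xi -> nodes k (V j') xi.
Proof.
move=> nx hx'; have hx := nodes_hull k0 (nd j) nx.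
have [s hs] := bary_match tri hx hx'.
have [a /= ak axi] := nx.
exists (fun i => a ((s^-1)%g i)) => /=.
  by rewrite -ak [RHS](reindex_inj (@perm_inj _ (s^-1)%g)).
apply: (bary_inj (nd j')) => i; rewrite bary_lattice_pt//; last first.
  by rewrite -ak [RHS](reindex_inj (@perm_inj _ (s^-1)%g)).
by rewrite -[i in RHS](permKV s) -hs// -axi bary_lattice_pt.
Qed.

Lemma hexd_match j j' : hull (V j) xi -> hull (V j') xi ->
  exists s : {perm 'I_3}, forall x, hull (V j) x -> hull (V j') x ->
    forall i, hexd k (V j) xi i x = hexd k (V j') xi (s i) x.
Proof.
move=> h h'; have [s hs] := bary_match tri h h'.
by exists s => x hx hx' i; rewrite /hexd !hs.
Qed.

(** The hexagon inequalities range over all ordered pairs of indices, so the permutation of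
    coordinates merely rearranges them. *)
Lemma tcell_match j j' x : nodes k (V j) xi -> nodes k (V j') xi ->
  hull (V j) x -> hull (V j') x -> tcell k (V j) xi x -> tcell k (V j') xi x.
Proof.
move=> nx nx' hx hx'; rewrite !tcellE//= => -[_ hd]; split=> // i m.
have [s hs] := hexd_match (nodes_hull k0 (nd j) nx) (nodes_hull k0 (nd j') nx').
by rewrite -(permKV s i) -(permKV s m) -!hs.
Qed.

Lemma edge_through_node j i x : nodes k (V j) xi -> on_edge V j i x ->
  bary (V j) i xi = 0 ->
  exists j', [/\ j != j', hull (V j') x & nodes k (V j') xi].
Proof.
move=> nx ex zxi; have hxi := nodes_hull k0 (nd j) nx.
have [j' jj' hj'] := neighbour tri oOm Oxi hxi zxi.
exists j'; split=> //.
  by apply: hj'; [exact: (on_edge_hull tri ex)|exact: ex.1].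
by apply: (node_transfer nx); exact: hj'.
Qed.

(* Dual cells of the two elements sharing an edge through xi have the same trace
   on it, so the control volume is a neighbourhood of the inner points of that
   trace and its boundary is made of dual edges. *)
Lemma near_control_edge j i x : nodes k (V j) xi -> on_edge V j i x ->
  tcell k (V j) xi x -> ~ special k (V j) xi x -> \forall y \near x, C y.
Proof.
move=> nx ex tx nsp.
have zxi := tcell_edge k0 (nd j) nx tx ex.1.
have [j' [jj' hx' nx']] := edge_through_node nx ex zxi.
have hx := on_edge_hull tri ex.
have di : hexd k (V j) xi i x = 0 by rewrite /hexd ex.1 zxi subrr mulr0.
(* A tight constraint on an edge through the node would make [x] special; strictness then passes to
   the neighbour by the permutation. *)
have st p q : p != q -> hexd k (V j) xi p x - hexd k (V j) xi q x < 1.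
  move=> pq; move: tx; rewrite tcellE//= => -[_ hd].
  by rewrite lt_neqAle hd andbT; apply/eqP => e; apply: nsp; exact: special_edge di pq e.
have [s hs] := hexd_match (nodes_hull k0 (nd j) nx) (nodes_hull k0 (nd j') nx').
have st' p q : p != q -> hexd k (V j') xi p x - hexd k (V j') xi q x < 1.
  move=> pq; rewrite -(permKV s p) -(permKV s q) -!hs//; apply: st.
  by rewrite (inj_eq perm_inj).
have n1 := strict_tcell_near k0 (nd j) nx st.
have n2 := strict_tcell_near k0 (nd j') nx' st'.
apply: filterS3 n1 n2 (near_union tri jj' ex hx') => y h1 h2 [hy|hy].
  by exists j => //; exact: h1.
by exists j' => //; exact: h2.
Qed.

Lemma near_interior_hull j x : (forall i, 0 < bary (V j) i x) ->
  \forall y \near x, forall i, 0 < bary (V j) i y.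
Proof. by move=> h; apply: near_all3 => i; exact: near_bary_gt0. Qed.

Lemma near_control_in j x : nodes k (V j) xi -> (forall i, 0 < bary (V j) i x) ->
  \forall y \near x, C y <-> tcell k (V j) xi y.
Proof.
move=> nx /near_interior_hull; apply: filterS => y iy; split => [[j' /= nx' ty]|ty].
  by have <- := interior_disjoint tri iy (tcell_hull nx' ty).
by exists j.
Qed.

Lemma control_out j x : ~ nodes k (V j) xi -> (forall i, 0 < bary (V j) i x) -> ~ C x.
Proof.
move=> nnx ix [j' /= nx' tx]; apply: nnx.
by have <- := interior_disjoint tri ix (tcell_hull nx' tx).
Qed.

Lemma closed_control : closed C.
Proof.
apply: closed_bigcup => [|j /= nx]; first exact: finite_finset.
exact: closed_tcell.
Qed.

Lemma frontier_control_sub x : frontier C x -> C x.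
Proof. by move=> [cx _]; rewrite ((closure_id _).1 closed_control). Qed.

Definition corners : set pt := [set x | exists j i, x = V j i].

Definition exceptional : set pt := corners `|`
  \bigcup_(j in [set j | nodes k (V j) xi]) special k (V j) xi.

Lemma finite_corners : finite_set corners.
Proof.
have -> : corners = (fun ji : J * 'I_3 => V ji.1 ji.2) @` setT.
  by apply/seteqP; split=> x /=;
    [move=> [j [i ->]]; exists (j, i)|move=> [[j i] _ <-]; exists j, i].
by apply: finite_image; exact: finite_finset.
Qed.

Lemma finite_exceptional : finite_set exceptional.
Proof.
rewrite finite_setU; split; first exact: finite_corners.
apply: bigcup_finite => [|j /= nx]; first exact: finite_finset.
exact: finite_special.
Qed.

Lemma frontier_control_in x : ~ exceptional x -> frontier C x ->
  exists2 j, nodes k (V j) xi & forall i, 0 < bary (V j) i x.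
Proof.
move=> nex fx; have [j /= nx tx] := frontier_control_sub fx.
exists j => //; apply: contrapT => nix.
have [[i ex]|[i e]] := not_on_edge_vertex tri (tcell_hull nx tx) nix; last first.
  by apply: nex; left; exists j, i.
apply: fx.2; apply: (near_control_edge nx ex tx) => sp.
by apply: nex; right; exists j.
Qed.

(** The common family of lines for all line integrals: the mesh edges and the hexagon sides, indexed
    by all elements so that the family does not vary with the integral. *)
Definition mesh_line (z : J * ('I_3 + 'I_3 * 'I_3)) : pt -> R :=
  match z.2 with
  | inl i => bary (V z.1) i
  | inr pq => hexc k (V z.1) xi pq
  end.

Lemma mesh_line_affine z : affine (mesh_line z).
Proof.
by case: z => j [i|pq]; rewrite /mesh_line /=; [exact: bary_affine|exact: hexc_affine].
Qed.

Lemma frontier_hull_lines j : frontier (hull (V j)) `<=` zeros_of mesh_line.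
Proof.
move=> x; rewrite frontier_hullE//= => -[hx [i e]].
by exists (j, inl i) => //; exact: alin_bary.
Qed.

Lemma dual_edge_lines j : nodes k (V j) xi ->
  dual_edge k (V j) xi `<=` zeros_of mesh_line.
Proof.
move=> nx x /dual_edgeE[]// _ _ [p [q [pq e]]].
by exists (j, inr (p, q)) => //; exact: hexc_nonconst.
Qed.

Lemma frontier_control_lines : frontier C `<=` zeros_of mesh_line.
Proof.
move=> x fx; have [j /= nx tx] := frontier_control_sub fx.
have [ix|nix] := pselect (forall i, 0 < bary (V j) i x).
  apply: (@dual_edge_lines j nx); split.
    exact: frontier_near (near_control_in nx ix) fx.
  by rewrite interior_hullE.
have hx := tcell_hull nx tx.
apply: (@frontier_hull_lines j); rewrite frontier_hullE//=; split=> //.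
apply: contrapT => h; apply: nix => i; rewrite lt_neqAle.
move: hx; rewrite hullE//= => ->; rewrite andbT; apply/eqP => e.
by apply: h; exists i.
Qed.

End ControlVolume.

(** * Nodal basis functions *)

Section NodalPolynomial.
Context {R : realType}.
Notation pt := (R * R)%type.
Implicit Types (V : 'I_3 -> pt) (x xi : pt).

(** The integer coordinates of a node in the lattice; the truncation is exact there. *)
Definition node_index (k : nat) V xi (i : 'I_3) : nat :=
  Num.truncn (k%:R * bary V i xi).

(* Classical product formula for the Lagrange basis on the principal lattice. *)
Definition nodal_poly (k : nat) V xi x : R :=
  \prod_i \prod_(m < node_index k V xi i)
    ((k%:R * bary V i x - m%:R) / (node_index k V xi i - m)%:R).

Lemma Pk_mul_prod_affine (m n : nat) (p : pt -> R) (F : 'I_n -> pt -> R) :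
  Pk m p -> (forall i, affine (F i)) ->
  Pk (n + m) (fun x => (\prod_(i < n) F i x) * p x).
Proof.
move=> pm; elim: n F => [|n IH] F aF.
  by under eq_fun do rewrite big_ord0 mul1r; exact: pm.
under eq_fun do rewrite big_ord_recl -mulrA.
by apply: Pk_mul_affine => //; exact: IH.
Qed.

Lemma nodal_poly_Pk_sum k V xi :
  Pk (\sum_i node_index k V xi i) (nodal_poly k V xi).
Proof.
rewrite /nodal_poly; elim: (index_enum _) => [|i r IH].
  rewrite big_nil [X in Pk _ X](_ : _ = fun=> 1); first exact: Pk_cst.
  by apply/funext => x; rewrite big_nil.
rewrite big_cons [X in Pk _ X](_ : _ = fun x =>
  (\prod_(m < node_index k V xi i)
    ((k%:R * bary V i x - m%:R) / (node_index k V xi i - m)%:R)) *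
  \prod_(j <- r) \prod_(m < node_index k V xi j)
    ((k%:R * bary V j x - m%:R) / (node_index k V xi j - m)%:R)); last first.
  by apply/funext => x; rewrite big_cons.
apply: (Pk_mul_prod_affine IH) => m.
have := affineZ ((node_index k V xi i - m)%:R^-1)
  (affineB (affineZ k%:R (bary_affine V i)) (affine_cst m%:R)).
by under eq_fun do rewrite mulrC.
Qed.

Section OneNode.
Variables (k : nat) (V : 'I_3 -> pt) (xi : pt).
Hypothesis k0 : (0 < k)%N.
Hypothesis nd : Defs.nondegenerate V.
Hypothesis nx : nodes k V xi.

Let kR : (k%:R : R) != 0.
Proof. by rewrite pnatr_eq0 -lt0n. Qed.

Lemma node_indexE zeta i : nodes k V zeta ->
  (node_index k V zeta i)%:R = k%:R * bary V i zeta.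
Proof.
move=> [a /= ak <-]; rewrite /node_index bary_lattice_pt//.
by rewrite [k%:R * _]mulrC mulfVK// natrK.
Qed.

Lemma node_index_sum zeta : nodes k V zeta ->
  (\sum_i node_index k V zeta i = k)%N.
Proof.
move=> nz; apply/eqP; rewrite -(eqr_nat R) natr_sum.
under eq_bigr do rewrite node_indexE//.
by rewrite -mulr_sumr bary_sum mulr1.
Qed.

Lemma nodal_poly_Pk : Pk k (nodal_poly k V xi).
Proof. by have := nodal_poly_Pk_sum k V xi; rewrite node_index_sum. Qed.

Lemma nodal_poly_self : nodal_poly k V xi xi = 1.
Proof.
rewrite /nodal_poly big1// => i _; rewrite big1// => m _.
by rewrite -node_indexE// natrB 1?ltnW// divff// -natrB 1?ltnW// pnatr_eq0 subn_eq0 -ltnNge.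
Qed.

Lemma nodal_poly_factor0 i x (m : nat) : (m < node_index k V xi i)%N ->
  k%:R * bary V i x = m%:R -> nodal_poly k V xi x = 0.
Proof.
move=> mi e; rewrite /nodal_poly (bigD1 i)//= (bigD1 (Ordinal mi))//=.
by rewrite e subrr !mul0r.
Qed.

(** Lattice indices of nodes have the same sum [k], so a different node has a strictly smaller index
    somewhere, and a factor vanishes there. *)
Lemma nodal_poly_other zeta : nodes k V zeta -> zeta <> xi ->
  nodal_poly k V xi zeta = 0.
Proof.
move=> nz ne; have [[i lt]|h] := pselect (exists i,
    (node_index k V zeta i < node_index k V xi i)%N).
  by apply: (nodal_poly_factor0 lt); rewrite node_indexE.
exfalso; apply: ne.
have le i : (node_index k V xi i <= node_index k V zeta i)%N.
  by rewrite leqNgt; apply/negP => lt; apply: h; exists i.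
have : (\sum_i (node_index k V zeta i - node_index k V xi i) = 0)%N.
  rewrite sumnB => [|i _]; last exact: le.
  by rewrite !node_index_sum// subnn.
move/eqP; rewrite sum_nat_eq0 => /forallP e.
apply: (bary_inj nd) => i; apply: (mulfI kR); rewrite -!node_indexE//.
by congr (_ %:R); apply/eqP; rewrite eqn_leq le andbT -subn_eq0 (implyP (e i)).
Qed.

(** If the node is off the edge [i], the product contains the factor with [m = 0], which vanishes on
    that edge. *)
Lemma nodal_poly_support x : nodal_poly k V xi x <> 0 ->
  forall i, bary V i x = 0 -> bary V i xi = 0.
Proof.
move=> p0 i zx; apply: contrapT => /eqP nz; apply: p0.
apply: (@nodal_poly_factor0 i x 0%N); last by rewrite zx mulr0.
by rewrite lt0n -(pnatr_eq0 R) node_indexE// mulf_neq0.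
Qed.

Lemma Itau_nodal x : Itau k V (nodal_poly k V xi) x = \1_(tcell k V xi) x.
Proof.
rewrite /Itau; transitivity (\sum_(z \in [set xi]) nodal_poly k V xi z * \1_(tcell k V z) x).
  apply/esym/fsbig_widen; first by move=> z ->.
  by move=> z [nz /= /nodal_poly_other ->] //; rewrite mul0r.
by rewrite fsbig_set1 nodal_poly_self mul1r.
Qed.

Lemma lint0 (B : set pt) (h : pt -> R) : (forall x, h x = 0) -> lint B h = 0.
Proof.
move=> h0; rewrite /lint fsbig1// => l _.
rewrite /Rintegral (eq_integral (cst 0%E)) ?integral0//.
by move=> t _ /=; rewrite h0.
Qed.

Lemma btau_nodal (kappa v : pt -> R) : btau k kappa V v (nodal_poly k V xi) =
  - lint (dual_edge k V xi) (fun x =>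
      dot (kappa x *: grad v x) (onormal (tcell k V xi) x)).
Proof.
rewrite /btau; congr (- _).
transitivity (\sum_(z \in [set xi]) lint (dual_edge k V z) (fun x =>
    dot (kappa x *: grad v x) (onormal (tcell k V z) x) * nodal_poly k V xi z)).
  apply/esym/fsbig_widen; first by move=> z ->.
  move=> z [nz /= /nodal_poly_other zE]; apply: lint0 => x.
  by rewrite zE// mulr0.
rewrite fsbig_set1; congr lint; apply/funext => x.
by rewrite nodal_poly_self mulr1.
Qed.

End OneNode.

End NodalPolynomial.

(** Pasting lemma for finitely many closed pieces, here the elements. *)
Lemma within_finite_cover_continuous (T U : topologicalType) (I : finType)
    (A : I -> set T) (w : T -> U) (p : I -> T -> U) :
  (forall i, closed (A i)) -> (forall i, continuous (p i)) ->
  (forall i x, A i x -> w x = p i x) -> {within \bigcup_i A i, continuous w}.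
Proof.
move=> cA cp wp.
have h (s : seq I) : {within \big[setU/set0]_(i <- s) A i, continuous w}.
  elim: s => [|i s IH]; first by rewrite big_nil; exact: continuous_subspace0.
  rewrite big_cons; apply: withinU_continuous => //; first exact: closed_bigsetU.
  apply: (@subspace_eq_continuous _ _ _ (p i)); last exact: continuous_subspaceT.
  by move=> x; rewrite inE => /wp.
have := h (index_enum I); rewrite -bigcup_seq.
rewrite (_ : [set` index_enum I] = setT)//.
by apply/seteqP; split=> x // _; rewrite /= mem_index_enum.
Qed.

Section NodalFunction.
Context {R : realType}.
Notation pt := (R * R)%type.
Variables (k : nat) (Om : set pt) (J : finType) (V : J -> 'I_3 -> pt) (xi : pt).
Hypothesis k0 : (0 < k)%N.
Hypothesis tri : triangulation Om V.
Hypothesis oOm : open Om.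
Hypothesis rOm : interior (closure Om) `<=` Om.
Hypothesis Oxi : Om xi.

Let nd j : Defs.nondegenerate (V j).
Proof. by have [_ + _] := tri. Qed.

(** The product runs over all coordinates and is thus insensitive to the permutation relating them
    on the common face. *)
Lemma nodal_poly_match j j' x : nodes k (V j) xi -> nodes k (V j') xi ->
  hull (V j) x -> hull (V j') x ->
  nodal_poly k (V j) xi x = nodal_poly k (V j') xi x.
Proof.
move=> nx nx' hx hx'.
have hxi := nodes_hull k0 (nd j) nx; have hxi' := nodes_hull k0 (nd j') nx'.
have [s hs] := bary_match tri hxi hxi'.
rewrite /nodal_poly [RHS](reindex_inj (@perm_inj _ s)) /=.
apply: eq_bigr => i _.
have e : node_index k (V j) xi i = node_index k (V j') xi (s i).
  by rewrite /node_index hs.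
by rewrite -e; apply: eq_bigr => m _; rewrite hs.
Qed.

(** Any element at [x] having [xi] as a node may be picked: [nodal_poly_match] makes the value
    independent of the choice. *)
Definition nodal_fun (x : pt) : R :=
  if [pick j | `[< hull (V j) x /\ nodes k (V j) xi >]] is Some j
  then nodal_poly k (V j) xi x else 0.

Lemma nodal_fun_on j x : nodes k (V j) xi -> hull (V j) x ->
  nodal_fun x = nodal_poly k (V j) xi x.
Proof.
move=> nx hx; rewrite /nodal_fun; case: pickP => [j' /asboolP[hx' nx']|/(_ j)].
  exact: nodal_poly_match.
by move/asboolP; case.
Qed.

(** A nonzero value at [x] puts [xi] in the smallest face through [x], hence in every element
    containing [x]. *)
Lemma nodal_fun_off j x : ~ nodes k (V j) xi -> hull (V j) x -> nodal_fun x = 0.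
Proof.
move=> nnx hx; rewrite /nodal_fun; case: pickP => [j' /asboolP[hx' nx']|//].
apply: contrapT => /(nodal_poly_support k0 (nd j') nx') sx; apply: nnx.
apply: (node_transfer k0 tri nx').
exact: (face_sub tri hx' hx (nodes_hull k0 (nd j') nx')).
Qed.

Lemma nodal_fun_Vh : Vh k Om V nodal_fun.
Proof.
have hp j : exists2 p, Pk k p & forall x, hull (V j) x -> nodal_fun x = p x.
  have [nx|nnx] := pselect (nodes k (V j) xi).
    exists (nodal_poly k (V j) xi); first exact: nodal_poly_Pk.
    by move=> x; exact: nodal_fun_on.
  by exists (cst 0); [exact: Pk_cst|move=> x; exact: nodal_fun_off].
split; first split=> //.
  have [-> _ _] := tri; have /choice[p hp'] : forall j, exists p,
      Pk k p /\ forall x, hull (V j) x -> nodal_fun x = p x.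
    by move=> j; have [p] := hp j; exists p.
  apply: (within_finite_cover_continuous (p := p)) => j.
  - exact: closed_hull.
  - by apply: (Pk_C1 (hp' j).1).1.
  - exact: (hp' j).2.
move=> x fx; have : closure Om x by case: fx.
have [-> _ _] := tri => -[j _ hx].
have [nx|nnx] := pselect (nodes k (V j) xi); last exact: nodal_fun_off nnx hx.
rewrite (nodal_fun_on nx hx); apply: contrapT => /(nodal_poly_support k0 (nd j) nx).
exact: (frontier_support tri oOm rOm Oxi (nodes_hull k0 (nd j) nx) hx fx).
Qed.

End NodalFunction.

(** * Measurable pieces and extension by zero *)

Section AffineMeasurable.
Context {R : realType}.
Notation pt := (R * R)%type.

Lemma affine_preimage_measurable (a : pt -> R) (B : set R) : affine a ->
  measurable B -> measurable (a @^-1` B).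
Proof.
move=> ha mB; rewrite -[X in measurable X]setTI.
by apply: plane_continuous_measurable => //; exact: affine_continuous.
Qed.

Lemma affine_zero_measurable (a : pt -> R) : affine a -> measurable [set x | a x = 0].
Proof. by move=> ha; apply: (affine_preimage_measurable ha (B := [set 0])). Qed.

Lemma affine_pos_measurable (a : pt -> R) : affine a -> measurable [set x | 0 < a x].
Proof.
move=> ha; have -> : [set x | 0 < a x] = a @^-1` `]0, +oo[.
  by apply/seteqP; split => x; rewrite /= in_itv /= andbT.
exact: affine_preimage_measurable.
Qed.

Lemma plane_closed_measurable (A : set pt) : closed A -> measurable A.
Proof.
move=> cA; rewrite -[A]setCK; apply: measurableC.
by apply: plane_open_measurable; exact: closed_openC.
Qed.

Lemma indic_in (A : set pt) x : A x -> \1_A x = 1 :> R.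
Proof. by move=> Ax; rewrite indicE mem_set. Qed.

Lemma indic_out (A : set pt) x : ~ A x -> \1_A x = 0 :> R.
Proof. by move=> Ax; rewrite indicE memNset. Qed.

Lemma patch_in (T : Type) (A : set T) (h : T -> R) x : A x -> (h \_ A) x = h x.
Proof. by move=> Ax; rewrite /patch mem_set. Qed.

Lemma patch_out (T : Type) (A : set T) (h : T -> R) x : ~ A x -> (h \_ A) x = 0.
Proof. by move=> Ax; rewrite /patch memNset. Qed.

Lemma sum_one (I : finType) (P : pred I) (F : I -> R) i : P i ->
  (forall j, j != i -> P j -> F j = 0) -> \sum_(j | P j) F j = F i.
Proof.
move=> Pi h; rewrite (bigD1 i)//= big1 ?addr0// => j /andP[Pj ji]; exact: h.
Qed.

End AffineMeasurable.

(** * Conservation around one interior node *)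

Section LocalConservation.
Context {R : realType}.
Notation pt := (R * R)%type.
Variables (k : nat) (Om : set pt) (f kappa : pt -> R) (K : R).
Variables (J : finType) (V : J -> 'I_3 -> pt) (uh : pt -> R) (gb : pt -> pt).
Variables (ut : J -> pt -> R) (xi : pt).
Hypothesis k0 : (0 < k)%N.
Hypothesis oOm : open Om.
Hypothesis rOm : interior (closure Om) `<=` Om.
Hypothesis fL2 : L2 Om f.
Hypothesis mkappa : measurable_fun Om kappa.
Hypothesis bkappa : forall x, Om x -> `|kappa x| <= K.
Hypothesis tri : triangulation Om V.
Hypothesis Oxi : Om xi.
Hypothesis uh_fe : fe_fun k Om V uh.

Let nd j : Defs.nondegenerate (V j).
Proof. by have [_ + _] := tri. Qed.

Let mOm : measurable Om.
Proof. exact: plane_open_measurable. Qed.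

Local Notation C := (control_volume k V xi).
Local Notation N j := `[< nodes k (V j) xi >].
Local Notation phi j := (nodal_poly k (V j) xi).
Local Notation p_ j := (restr k (V j) uh).
Local Notation w := (nodal_fun k V xi).
Local Notation intj j := (interior (hull (V j))).
Local Notation t_ j := (tcell k (V j) xi).

Lemma intjP j x : intj j x <-> forall i, 0 < bary (V j) i x.
Proof. by rewrite interior_hullE. Qed.

Lemma intj_Om j : intj j `<=` Om.
Proof. by move=> x /intjP ix; exact: (interior_hull_Om tri rOm ix). Qed.

Lemma intj_sub j x : intj j x -> hull (V j) x.
Proof. exact: interior_subset. Qed.

Lemma intj_unique j j' x : intj j x -> hull (V j') x -> j' = j.
Proof. by move=> /intjP ix hx; exact: (interior_disjoint tri ix hx). Qed.

Lemma near_intj j x : intj j x -> \forall y \near x, intj j y.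
Proof. by move=> ix; apply: open_nbhs_nbhs; split=> //; exact: open_interior. Qed.

Lemma nice_kappa (j : J) (A : set pt) : measurable A -> A `<=` Om ->
  A `<=` hull (V j) -> nice (kappa \_ A).
Proof.
move=> mA AO Ah; have [M hM] := hull_bounded (V j).
apply: (nice_restrict mkappa mOm mA AO bkappa (M := M)) => x Ax; exact: hM (Ah _ Ax).
Qed.

Lemma measurable_intj j : measurable (intj j).
Proof. by apply: plane_open_measurable; exact: open_interior. Qed.

Lemma nice_indic_intj j : nice (\1_(intj j) : pt -> R).
Proof.
have [M hM] := hull_bounded (V j).
split; first by apply: measurable_indic; exact: measurable_intj.
exists (`|M| + 1); split => x.
  by rewrite indicE; case: (_ \in _); rewrite ?normr1 ?normr0 ?lerDr ?addr_ge0.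
move=> nbx; rewrite indic_out// => /intj_sub/hM bx; apply: nbx.
by apply: le_box bx; apply: le_trans (ler_norm _) _; rewrite lerDl.
Qed.

Lemma restr_fe j : forall x, hull (V j) x -> uh x = p_ j x.
Proof.
rewrite /restr; case: xgetP => [p _ [_ h]|h]; first exact: h.
have [_ /(_ j) [p pk hp]] := uh_fe.
by exfalso; apply: (h p).
Qed.

(** On the open element [uh] equals its polynomial in a whole neighbourhood, as a two-sided
    derivative requires. *)
Lemma grad_uh j x : intj j x -> grad uh x = grad (p_ j) x.
Proof.
move=> /near_intj h; apply: grad_near; apply: filterS h => y /intj_sub.
exact: restr_fe.
Qed.

Lemma phi_C1 j : nodes k (V j) xi -> C1 (phi j).
Proof. by move=> nx; apply: Pk_C1 (nodal_poly_Pk k0 (nd j) nx). Qed.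

(** * Area integrals *)

(** The lines carrying the edges, whole rather than cut to the edges: still a null set, and simpler
    to describe. *)
Definition mesh_null : set pt :=
  \bigcup_(z in [set: J * 'I_3]) [set x | bary (V z.1) z.2 x = 0].

Lemma mesh_nullP : measurable mesh_null /\ leb2 mesh_null = 0%E.
Proof.
have fm (z : J * 'I_3) : measurable [set x | bary (V z.1) z.2 x = 0] /\
    leb2 [set x | bary (V z.1) z.2 x = 0] = 0%E.
  by apply: plane_line_null; [exact: bary_affine|exact: alin_bary].
have mm : measurable mesh_null.
  by apply: fin_bigcup_measurable => [|z _]; [exact: finite_finset|exact: (fm z).1].
split=> //.
have -> : mesh_null = \big[setU/set0]_(z <- index_enum (J * 'I_3)%type)
    [set x | bary (V z.1) z.2 x = 0].
  rewrite -bigcup_seq /mesh_null; congr bigcup.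
  by apply/seteqP; split=> z // _; rewrite /= mem_index_enum.
elim: (index_enum _) => [|z s IH]; first by rewrite big_nil; exact: measure0.
rewrite big_cons.
have := @measureU0 _ _ _ (@leb2 R : {measure set _ -> \bar R}) _ _ (fm z).1 _ IH.
move=> ->; first exact: (fm z).2.
by apply: bigsetU_measurable => i _; exact: (fm i).1.
Qed.

Lemma mesh_null_intj j x : ~ mesh_null x -> hull (V j) x -> intj j x.
Proof.
move=> nx; rewrite interior_hullE//= hullE//= => hx i.
rewrite lt_neqAle hx andbT; apply/eqP => e; apply: nx.
by exists (j, i).
Qed.

(** Whole-plane integrands of the load on the dual cell, the load against the basis function ([F2])
    and the stiffness term ([FA]). They are cut off to the open element, which lies in [Om], whereas
    the closed one may touch the boundary. *)
Definition F1 j x := (f \_ Om) x * (\1_(intj j) x * \1_(t_ j) x).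
Definition F2 j x := (f \_ Om) x * (\1_(intj j) x * phi j x).
Definition FA j x := (kappa \_ (intj j)) x * dot (grad (p_ j) x) (grad (phi j) x).

Lemma iF1 j : nodes k (V j) xi -> (@leb2 R).-integrable setT (EFin \o F1 j).
Proof.
move=> nx; apply: L2_nice_integrable => //.
apply: nice_indic_mul; first exact: nice_indic_intj.
by apply: plane_closed_measurable; exact: closed_tcell.
Qed.

Lemma iF2 j : nodes k (V j) xi -> (@leb2 R).-integrable setT (EFin \o F2 j).
Proof.
move=> nx; apply: L2_nice_integrable => //.
apply: nice_mul_continuous; first exact: nice_indic_intj.
exact: (phi_C1 nx).1.
Qed.

Lemma iFA j : nodes k (V j) xi -> (@leb2 R).-integrable setT (EFin \o FA j).
Proof.
move=> nx; apply: nice_integrable; apply: nice_mul_continuous.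
  apply: (@nice_kappa j); [exact: measurable_intj|exact: intj_Om|exact: intj_sub].
by apply: C1_grad_grad; [exact: restr_C1|exact: phi_C1].
Qed.

Lemma leb2_null_modification (D : set pt) (h g : pt -> R) :
  (forall x, ~ mesh_null x -> (h \_ D) x = g x) ->
  \int[leb2]_(x in D) h x = \int[leb2]_x g x.
Proof.
have [mm m0] := mesh_nullP.
exact: (@Rintegral_null_modification _ _ _ (@leb2 R : {measure set _ -> \bar R}) _ _ _ _ mm m0).
Qed.

Lemma leb2_sum (F : J -> pt -> R) :
  (forall j, nodes k (V j) xi -> (@leb2 R).-integrable setT (EFin \o F j)) ->
  \int[leb2]_x (\sum_(j | N j) F j x) = \sum_(j | N j) \int[leb2]_x F j x.
Proof.
move=> iF; apply: (@Rintegral_sum _ _ _ (@leb2 R : {measure set _ -> \bar R}) _ _ _ _ _).2.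
by move=> j /asboolP; exact: iF.
Qed.

Lemma lform_hull j : nodes k (V j) xi ->
  lform f (hull (V j)) (fun x => \1_(t_ j) x - phi j x) =
  \int[leb2]_x F1 j x - \int[leb2]_x F2 j x.
Proof.
move=> nx.
have := @RintegralB _ _ _ (@leb2 R : {measure set _ -> \bar R}) setT (F1 j) (F2 j)
  measurableT (iF1 nx) (iF2 nx) => <-.
apply: leb2_null_modification => x nn.
have [hx|nhx] := pselect (hull (V j) x).
  have ix := mesh_null_intj nn hx.
  by rewrite (patch_in _ hx) /F1 /F2 (indic_in ix) (patch_in _ (intj_Om ix)); ring.
rewrite (patch_out _ nhx) /F1 /F2 (indic_out (A := intj j)); first by ring.
by move=> /intj_sub.
Qed.

Lemma aform_hull j : nodes k (V j) xi ->
  aform kappa (hull (V j)) uh (phi j) = \int[leb2]_x FA j x.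
Proof.
move=> nx; apply: leb2_null_modification => x nn.
have [hx|nhx] := pselect (hull (V j) x).
  have ix := mesh_null_intj nn hx.
  by rewrite (patch_in _ hx) /FA (patch_in _ ix) (grad_uh ix).
rewrite (patch_out _ nhx) /FA patch_out ?mul0r//.
by move=> /intj_sub.
Qed.

Lemma integral_control : \int[leb2]_(x in C) f x =
  \sum_(j | N j) \int[leb2]_x F1 j x.
Proof.
rewrite -leb2_sum; last exact: iF1.
apply: leb2_null_modification => x nn.
have [[j /= nx tx]|nC] := pselect (C x).
  have ix := mesh_null_intj nn (tcell_hull k0 tri nx tx).
  have Cx : C x by exists j.
  rewrite (patch_in _ Cx).
  rewrite (sum_one (i := j)); first last.
  - move=> j' jj' _; rewrite /F1 (indic_out (A := intj j')) ?mul0r ?mulr0//.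
    by move=> /intj_sub/(intj_unique ix)/eqP; rewrite (negPf jj').
  - exact/asboolP.
  by rewrite /F1 (indic_in ix) (indic_in tx) (patch_in _ (intj_Om ix)) !mulr1.
rewrite (patch_out _ nC) big1// => j /asboolP nx.
rewrite /F1 (indic_out (A := t_ j)) ?mulr0// => tx.
by apply: nC; exists j.
Qed.

Lemma Om_intj x : ~ mesh_null x -> Om x -> exists j, intj j x.
Proof.
move=> nn Ox; have : closure Om x by exact: subset_closure.
have [-> _ _] := tri => -[j _ hx].
by exists j; exact: mesh_null_intj.
Qed.

Lemma lform_Om : lform f Om w = \sum_(j | N j) \int[leb2]_x F2 j x.
Proof.
rewrite -leb2_sum; last exact: iF2.
apply: leb2_null_modification => x nn.
have [Ox|nO] := pselect (Om x); last first.
  rewrite (patch_out _ nO) big1// => j _.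
  by rewrite /F2 (patch_out _ nO) mul0r.
have [j ix] := Om_intj nn Ox; rewrite (patch_in _ Ox).
have z j' : j' != j -> F2 j' x = 0.
  move=> jj'; rewrite /F2 (indic_out (A := intj j')) ?mul0r ?mulr0//.
  by move=> /intj_sub/(intj_unique ix)/eqP; rewrite (negPf jj').
have [nx|nnx] := pselect (nodes k (V j) xi).
  rewrite (sum_one (i := j)); [|exact/asboolP|by move=> j' /z].
  by rewrite /F2 (indic_in ix) (patch_in _ (intj_Om ix)) mul1r
    (nodal_fun_on k0 tri nx (intj_sub ix)).
rewrite (nodal_fun_off k0 tri nnx (intj_sub ix)) mulr0 big1// => j' /asboolP nx'.
by apply: z; apply/eqP => e; apply: nnx; rewrite -e.
Qed.

Lemma aform_Om : aform kappa Om uh w = \sum_(j | N j) \int[leb2]_x FA j x.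
Proof.
rewrite -leb2_sum; last exact: iFA.
apply: leb2_null_modification => x nn.
have [Ox|nO] := pselect (Om x); last first.
  rewrite (patch_out _ nO) big1// => j _; rewrite /FA patch_out ?mul0r//.
  by move=> /intj_Om.
have [j ix] := Om_intj nn Ox; rewrite (patch_in _ Ox).
have z j' : j' != j -> FA j' x = 0.
  move=> jj'; rewrite /FA patch_out ?mul0r//.
  by move=> /intj_sub/(intj_unique ix)/eqP; rewrite (negPf jj').
have [nx|nnx] := pselect (nodes k (V j) xi).
  rewrite (sum_one (i := j)); [|exact/asboolP|by move=> j' /z].
  rewrite /FA (patch_in _ ix) (grad_uh ix) (@grad_near _ w (phi j))//.
  by apply: filterS (near_intj ix) => y /intj_sub hy; exact: (nodal_fun_on k0 tri nx hy).
rewrite (@grad_near _ w (fun=> 0)).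
  rewrite grad_cst /dot /= !mulr0 addr0 mulr0 big1// => j' /asboolP nx'.
  by apply: z; apply/eqP => e; apply: nnx; rewrite -e.
by apply: filterS (near_intj ix) => y /intj_sub hy; exact: (nodal_fun_off k0 tri nnx hy).
Qed.

(** * Fluxes through the dual edges *)

Hypothesis utP : forall j, Pk k (ut j).

Local Notation mline := (mesh_line k V xi).
Local Notation unit_normal a := (- ((vlen (alin a))^-1 *: alin a)).

Definition dual_flux j x := dot (kappa x *: grad (ut j) x) (onormal (t_ j) x).

Definition dual_side j (pq : 'I_3 * 'I_3) : set pt :=
  [set x | hexc k (V j) xi pq x = 0] `&`
  \bigcap_(z in [set: 'I_3 * 'I_3]) [set x | 0 <= hexc k (V j) xi z x].

Lemma measurable_dual_side j pq : measurable (dual_side j pq).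
Proof.
apply: measurableI; first by apply: affine_zero_measurable; exact: hexc_affine.
apply: fin_bigcap_measurable => [|z _]; first exact: finite_finset.
by apply: plane_closed_measurable; apply: affine_ge0_closed; exact: hexc_affine.
Qed.

(** Representative of the dual flux in the class [nice]: the normal is constant on each side, and
    [kappa] is cut off to the open element. Sides overlap at corners, which are special points. *)
Definition dual_side_flux j x := \sum_(pq : 'I_3 * 'I_3 | pq.1 != pq.2)
  (kappa \_ (intj j)) x * \1_(dual_side j pq) x *
  dot (grad (ut j) x) (unit_normal (hexc k (V j) xi pq)).

Lemma nice_dual_side_flux j : nice (dual_side_flux j).
Proof.
apply: nice_sum => pq _; apply: nice_mul_continuous.
  apply: nice_indic_mul; last exact: measurable_dual_side.
  by apply: (@nice_kappa j); [exact: measurable_intj|exact: intj_Om|exact: intj_sub].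
by apply: C1_grad_dot; apply: Pk_C1; exact: utP.
Qed.

Lemma dotZl (c : R) (p q : pt) : dot (c *: p) q = c * dot p q.
Proof. by rewrite dotC dotZr dotC. Qed.

Lemma dual_flux_repr j x : nodes k (V j) xi -> ~ special k (V j) xi x ->
  (dual_flux j \_ (dual_edge k (V j) xi)) x = dual_side_flux j x.
Proof.
move=> nx nsp; have [dx|ndx] := pselect (dual_edge k (V j) xi x).
  rewrite (patch_in _ dx).
  have [ix hc [p [q [pq e]]]] := (dual_edgeE k0 (nd j) x nx).1 dx.
  have iix : intj j x by apply/intjP.
  (* Off the special points [x] lies on one side only. *)
  rewrite /dual_side_flux (sum_one (i := (p, q)))//; last first.
    move=> [p' q'] ne pq'; rewrite indic_out ?mulr0 ?mul0r// => -[e' _]; apply: nsp.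
    move: pq' e e'; rewrite /hexc /= => pq' e e'.
    apply: (special_corner (p := p) (q := q) pq pq'); [by rewrite eq_sym|lra|lra].
  rewrite (patch_in _ iix) indic_in; last by split=> // -[p' q'] _; exact: hc.
  rewrite mulr1 /dual_flux (onormal_tcell k0 (nd j) nx ix hc pq e nsp).
  by rewrite dotZl.
rewrite (patch_out _ ndx) /dual_side_flux big1// => -[p q] /= pq.
have [iix|nix] := pselect (intj j x); last by rewrite (patch_out _ nix) !mul0r.
rewrite indic_out ?mulr0 ?mul0r// => -[e hc]; apply: ndx.
apply/(dual_edgeE k0 (nd j) x nx); split; first exact/intjP.
  by move=> p' q'; exact: (hc (p', q')).
by exists p, q.
Qed.

Lemma lint_dual_edge j : nodes k (V j) xi ->
  lint (dual_edge k (V j) xi) (dual_flux j) =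
  \sum_(l \in lines_of mline) \int[lebesgue_measure]_t dual_side_flux j (line_at l t).
Proof.
move=> nx; apply: (lint_repr (E := special k (V j) xi)).
- exact: mesh_line_affine.
- exact: finite_special.
- exact: (dual_edge_lines k0 tri nx).
- by move=> x; exact: dual_flux_repr.
Qed.

Lemma dual_edge_intj j x : dual_edge k (V j) xi x -> intj j x.
Proof. by case. Qed.

Lemma flux_intj j x : intj j x -> flux V kappa ut x = - (kappa x *: grad (ut j) x).
Proof.
move=> ix; rewrite /flux; case: pickP => [j'|/(_ j)].
  by rewrite inE => /(intj_unique ix) ->.
by rewrite mem_set//; exact: intj_sub.
Qed.

(** Such a boundary point is inside one element, where the control volume and the dual cell coincide
    locally and so share frontier and normal. The sign is that of the flux, minus [kappa] times the
    gradient. *)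
Lemma frontier_control_flux x : ~ exceptional k V xi x ->
  ((fun y => dot (flux V kappa ut y) (onormal C y)) \_ (frontier C)) x =
  - \sum_(j | N j) dual_side_flux j x.
Proof.
move=> nex.
have -> : \sum_(j | N j) dual_side_flux j x =
    \sum_(j | N j) (dual_flux j \_ (dual_edge k (V j) xi)) x.
  apply: eq_bigr => j /asboolP nx; rewrite dual_flux_repr// => sp.
  by apply: nex; right; exists j.
have z j j' : intj j x -> j' != j -> (dual_flux j' \_ (dual_edge k (V j') xi)) x = 0.
  move=> ix jj'; apply: patch_out => /dual_edge_intj/intj_sub/(intj_unique ix)/eqP.
  by rewrite (negPf jj').
have [[j ix]|none] := pselect (exists j, intj j x); last first.
  rewrite patch_out ?big1 ?oppr0//; last first.
    move=> /(frontier_control_in k0 tri oOm Oxi nex)[j _ ix]; apply: none.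
    by exists j; apply/intjP.
  by move=> j _; apply: patch_out => /dual_edge_intj ix; apply: none; exists j.
have ix' := (intjP j x).1 ix.
have [nx|nnx] := pselect (nodes k (V j) xi); last first.
  rewrite patch_out ?big1 ?oppr0// => [j' /asboolP nx'|].
    by apply: z ix _; apply/eqP => e; apply: nnx; rewrite -e.
  move=> /(frontier_control_sub k0 tri).
  exact: (control_out k0 tri nnx ix').
rewrite (sum_one (i := j)); [|exact/asboolP|by move=> j' jj' _; exact: z ix jj'].
have nC := near_control_in k0 tri nx ix'.
have nC' : \forall y \near x, t_ j y <-> C y by apply: filterS nC => y [? ?].
have [fC|nfC] := pselect (frontier C x).
  have dx : dual_edge k (V j) xi x by split=> //; exact: frontier_near nC fC.
  rewrite (patch_in _ fC) (patch_in _ dx) (flux_intj ix) (onormal_near nC) /dual_flux.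
  by rewrite dotC dotNr dotC.
rewrite (patch_out _ nfC) patch_out ?oppr0// => -[ft _]; apply: nfC.
exact: frontier_near nC' ft.
Qed.

Lemma lint_control :
  lint (frontier C) (fun y => dot (flux V kappa ut y) (onormal C y)) =
  - \sum_(j | N j) lint (dual_edge k (V j) xi) (dual_flux j).
Proof.
rewrite (lint_repr (c := mline) (E := exceptional k V xi)
    (g := fun x => \sum_(j | N j) - dual_side_flux j x)).
- have nneg j : nice (fun x => - dual_side_flux j x).
    rewrite (_ : (fun x => _) = fun x => dual_side_flux j x * (-1)).
      by apply: nice_mul_continuous; [exact: nice_dual_side_flux|exact: cst_continuous].
    by apply/funext => x; rewrite mulrN1.
  apply: eq_trans (sum_line_integrals (P := fun j => N j)
    (g := fun j x => - dual_side_flux j x) (mesh_line_affine k V xi) _) _ => //.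
  rewrite -sumrN; apply: eq_bigr => j /asboolP nx; rewrite lint_dual_edge//.
  rewrite !fsbig_finite/=; try exact: finite_lines_of (mesh_line_affine k V xi).
  rewrite -sumrN; apply: eq_big_seq => l.
  rewrite in_fset_set; last exact: finite_lines_of (mesh_line_affine k V xi).
  move=> /set_mem h; have l1 := lines_of_unit h.
  apply: (@RintegralN _ _ _ (@lebesgue_measure R) (fun t => dual_side_flux j (line_at l t))).
  by apply: nice_line_integrable => //; exact: nice_dual_side_flux.
- exact: mesh_line_affine.
- exact: (finite_exceptional xi k0 tri).
- exact: (frontier_control_lines k0 tri).
- by move=> x nex; rewrite frontier_control_flux// sumrN.
Qed.

(** * Fluxes through the element edges *)

(** Closed form of [Itau phi - phi] on the element, by [Itau_nodal]. *)
Definition defect j x := \1_(t_ j) x - phi j x.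

Definition edge_flux j x :=
  dot (avg_flux k V kappa gb uh j x) (onormal (hull (V j)) x) * defect j x.

(** Neither the dual cell nor the basis function reaches an edge that misses the node. *)
Lemma defect_off_edge j i x : nodes k (V j) xi -> bary (V j) i x = 0 ->
  bary (V j) i xi <> 0 -> defect j x = 0.
Proof.
move=> nx zx nz; rewrite /defect indic_out; last first.
  by move=> tx; apply: nz; exact: (tcell_edge k0 (nd j) nx tx zx).
rewrite sub0r; apply/eqP; rewrite oppr_eq0; apply/eqP.
apply: contrapT => /(nodal_poly_support k0 (nd j) nx) h.
by apply: nz; exact: h.
Qed.

Lemma defect_match j j' x : nodes k (V j) xi -> nodes k (V j') xi ->
  hull (V j) x -> hull (V j') x -> defect j x = defect j' x.
Proof.
move=> nx nx' hx hx'; rewrite /defect (nodal_poly_match k0 tri nx nx' hx hx').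
congr (_ - _); have [tx|ntx] := pselect (t_ j x).
  by rewrite !indic_in//; exact: (tcell_match k0 tri nx nx' hx hx' tx).
rewrite !indic_out// => tx; apply: ntx.
exact: (tcell_match k0 tri nx' nx hx' hx tx).
Qed.

(** On an open edge the other element is unique, so the choice made in [avg_flux] is determined. *)
Lemma avg_flux_edge j j' i x : j != j' -> on_edge V j i x -> hull (V j') x ->
  avg_flux k V kappa gb uh j x =
  2^-1 *: (kappa x *: grad (p_ j) x + kappa x *: grad (p_ j') x).
Proof.
move=> jj' ex hx'; rewrite /avg_flux; case: pickP => [j1|/(_ j')].
  move=> /andP[]; rewrite eq_sym => jj1 /set_mem hx1.
  by rewrite (neighbour_unique tri jj1 jj' ex hx1 hx').
by rewrite /= eq_sym jj' mem_set.
Qed.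

Lemma onormal_edge j i x : on_edge V j i x ->
  onormal (hull (V j)) x = unit_normal (bary (V j) i).
Proof.
move=> ex; apply: onormal_halfplane; [exact: bary_affine|exact: alin_bary|exact: ex.1|].
exact: (near_edge_hull tri ex).
Qed.

(** Near [x] the other element is the half-plane of the negated coordinate of [j]; its normal can
    thus be computed from the same gradient. *)
Lemma onormal_opposite j j' i x : j != j' -> on_edge V j i x -> hull (V j') x ->
  onormal (hull (V j')) x = - onormal (hull (V j)) x.
Proof.
move=> jj' ex hx'; rewrite (onormal_edge ex).
have ha : affine (fun y => -1 * bary (V j) i y) by apply: affineZ; exact: bary_affine.
have aE : alin (fun y => -1 * bary (V j) i y) = - alin (bary (V j) i).
  by apply: ptP; rewrite /alin /=; ring.
have lE : vlen (- alin (bary (V j) i)) = vlen (alin (bary (V j) i)).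
  by rewrite /vlen dotNr dotC dotNr opprK.
rewrite (onormal_halfplane ha).
- by rewrite aE lE scalerN opprK.
- by rewrite aE oppr_eq0 alin_bary.
- by rewrite ex.1 mulr0.
- apply: filterS (near_opposite_hull tri jj' ex hx') => y.
  by rewrite mulN1r oppr_ge0.
Qed.

Lemma edge_flux_opposite j j' i x : j != j' -> nodes k (V j) xi -> nodes k (V j') xi ->
  on_edge V j i x -> hull (V j') x -> edge_flux j' x = - edge_flux j x.
Proof.
move=> jj' nx nx' ex hx'; have hx := on_edge_hull tri ex.
have [i' [c [ex' _ _]]] := opposite_edge tri jj' ex hx'.
have j'j : j' != j by rewrite eq_sym.
have avgE : avg_flux k V kappa gb uh j' x = avg_flux k V kappa gb uh j x.
  pose G i := kappa x *: grad (p_ i) x.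
  have e1 : avg_flux k V kappa gb uh j x = 2^-1 *: (G j + G j') := avg_flux_edge jj' ex hx'.
  have e2 : avg_flux k V kappa gb uh j' x = 2^-1 *: (G j' + G j) := avg_flux_edge j'j ex' hx.
  by rewrite e1 e2; clearbody G; rewrite [G j' + _]addrC.
rewrite /edge_flux avgE (onormal_opposite jj' ex hx') (defect_match nx nx' hx hx').
by move: (avg_flux _ _ _ _ _ _ _) (onormal _ _) (defect _ _) => u n c0; rewrite dotNr mulNr.
Qed.

Lemma edge_on_frontier j i x : on_edge V j i x -> frontier (hull (V j)) x.
Proof.
move=> ex; rewrite frontier_hullE//=; split; first exact: (on_edge_hull tri ex).
by exists i; exact: ex.1.
Qed.

Lemma frontier_on_edge j x : ~ corners V x -> frontier (hull (V j)) x ->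
  exists i, on_edge V j i x.
Proof.
move=> nc; rewrite frontier_hullE//= => -[hx [i e]].
have [|//|[m xE]] := not_on_edge_vertex tri hx.
  by move=> /(_ i); rewrite e ltxx.
by exfalso; apply: nc; exists j, m.
Qed.

Lemma measurable_on_edge j i : measurable (on_edge V j i).
Proof.
rewrite (_ : on_edge V j i = [set x | bary (V j) i x = 0] `&`
    \bigcap_(m in [set m | m != i]) [set x | 0 < bary (V j) m x]).
  apply: measurableI; first by apply: affine_zero_measurable; exact: bary_affine.
  apply: fin_bigcap_measurable => [|m _]; first exact: finite_finset.
  by apply: affine_pos_measurable; exact: bary_affine.
by apply/seteqP; split => x [h1 h2]; split.
Qed.

(** Chooses the neighbour once per edge instead of once per point, which turns the averaged flux
    along an edge into a continuous function times [kappa]. *)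
Lemma edge_neighbour : exists nb : J -> 'I_3 -> J, forall j i x,
  nodes k (V j) xi -> bary (V j) i xi = 0 -> on_edge V j i x ->
  [/\ j != nb j i, hull (V (nb j i)) x & nodes k (V (nb j i)) xi].
Proof.
have h (ji : J * 'I_3) : exists j', nodes k (V ji.1) xi -> bary (V ji.1) ji.2 xi = 0 ->
    forall x, on_edge V ji.1 ji.2 x ->
    [/\ ji.1 != j', hull (V j') x & nodes k (V j') xi].
  case: ji => j i /=; have [[nx z]|no] := pselect (nodes k (V j) xi /\ bary (V j) i xi = 0).
    have hxi := nodes_hull k0 (nd j) nx.
    have [j' jj' hj'] := neighbour tri oOm Oxi hxi z.
    exists j' => _ _ x ex; split=> //.
      by apply: hj'; [exact: (on_edge_hull tri ex)|exact: ex.1].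
    by apply: (node_transfer k0 tri nx); exact: hj'.
  by exists j => nx z; case: no.
have [nb hnb] := choice h.
by exists (fun j i => nb (j, i)) => j i x nx z ex; exact: (hnb (j, i) nx z x ex).
Qed.

(** The open edges through the node lie in [Om], where [kappa] is controlled; on the other edges the
    defect is zero, whatever the flux. This provides the integrability needed to exchange sums and
    integrals. *)
Lemma edge_flux_repr j : nodes k (V j) xi -> exists2 h, nice h &
  forall x, ~ corners V x -> (edge_flux j \_ (frontier (hull (V j)))) x = h x.
Proof.
move=> nx; have [nb hnb] := edge_neighbour.
(* Empty when the edge misses the node. *)
pose E i : set pt := [set x | bary (V j) i xi = 0 /\ on_edge V j i x].
pose h x := \sum_i (kappa \_ (E i)) x *
  (2^-1 * dot (grad (p_ j) x) (unit_normal (bary (V j) i)) +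
   2^-1 * dot (grad (p_ (nb j i)) x) (unit_normal (bary (V j) i))) * defect j x.
exists h.
  apply: nice_sum => i _; rewrite /defect.
  have EO : E i `<=` Om.
    move=> x [z ex]; have [jj' hx' _] := hnb j i x nx z ex.
    exact: (inner_edge_Om tri rOm jj' ex hx').
  have Eh : E i `<=` hull (V j) by move=> x [_ ex]; exact: (on_edge_hull tri ex).
  have mE : measurable (E i).
    have [z|nz] := pselect (bary (V j) i xi = 0).
      rewrite (_ : E i = on_edge V j i); first exact: measurable_on_edge.
      by apply/seteqP; split => x //= [].
    rewrite (_ : E i = set0); first exact: measurable0.
    by apply/seteqP; split => x //= [].
  have n1 : nice (fun x => (kappa \_ (E i)) x *
     (2^-1 * dot (grad (p_ j) x) (unit_normal (bary (V j) i)) +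
      2^-1 * dot (grad (p_ (nb j i)) x) (unit_normal (bary (V j) i)))).
    apply: nice_mul_continuous; first exact: (@nice_kappa j).
    move=> x; apply: cvgD; apply: cvgMl_tmp; apply: C1_grad_dot; exact: restr_C1.
  rewrite (_ : (fun x => _) = fun x => (kappa \_ (E i)) x *
     (2^-1 * dot (grad (p_ j) x) (unit_normal (bary (V j) i)) +
      2^-1 * dot (grad (p_ (nb j i)) x) (unit_normal (bary (V j) i))) * \1_(t_ j) x +
    (kappa \_ (E i)) x *
     (2^-1 * dot (grad (p_ j) x) (unit_normal (bary (V j) i)) +
      2^-1 * dot (grad (p_ (nb j i)) x) (unit_normal (bary (V j) i))) * (-1 * phi j x)); last first.
    by apply/funext => x; rewrite mulrDr mulN1r.
  apply: niceD.
    by apply: nice_indic_mul n1 _; apply: plane_closed_measurable; exact: closed_tcell.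
  apply: nice_mul_continuous n1 _ => x.
  by apply: cvgMl_tmp; exact: (phi_C1 nx).1.
move=> x nc; have [fx|nfx] := pselect (frontier (hull (V j)) x); last first.
  rewrite (patch_out _ nfx) /h big1// => i _; rewrite patch_out ?mul0r// => -[_ ex].
  by apply: nfx; exact: edge_on_frontier ex.
have [i ex] := frontier_on_edge nc fx; rewrite (patch_in _ fx).
have other m : m != i -> ~ E m x.
  by move=> mi [_ [e _]]; have := ex.2 m mi; rewrite e ltxx.
have [z|nz] := pselect (bary (V j) i xi = 0); last first.
  by rewrite /edge_flux /h (defect_off_edge nx ex.1 nz) mulr0 big1// => m _; rewrite mulr0.
have [jj' hx' nx'] := hnb j i x nx z ex.
have Ex : E i x by [].
rewrite /h (sum_one (i := i))//; last first.
  by move=> m mi _; rewrite (patch_out _ (other m mi)) !mul0r.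
rewrite (patch_in _ Ex) /edge_flux (avg_flux_edge jj' ex hx') (onormal_edge ex).
congr (_ * _); move: (kappa x) (grad _ x) (grad _ x) (- _) => c u v n.
by rewrite /dot /= !scaleRE; ring.
Qed.

(** A nonzero term places [x] on an open edge through the node; exactly two elements contain it, and
    their fluxes are opposite. *)
Lemma edge_flux_sum x : ~ corners V x ->
  \sum_(j | N j) (edge_flux j \_ (frontier (hull (V j)))) x = 0.
Proof.
move=> nc; set T := fun j => (edge_flux j \_ (frontier (hull (V j)))) x.
have [[j [nx Tj]]|all0] := pselect (exists j, nodes k (V j) xi /\ T j <> 0); last first.
  rewrite big1// => j /asboolP nx; apply: contrapT => Tj.
  by apply: all0; exists j.
have [fx|nfx] := pselect (frontier (hull (V j)) x); last first.
  by exfalso; apply: Tj; exact: patch_out.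
have [i ex] := frontier_on_edge nc fx.
have z : bary (V j) i xi = 0.
  apply: contrapT => nz; apply: Tj; rewrite /T (patch_in _ fx).
  by rewrite /edge_flux (defect_off_edge nx ex.1 nz) mulr0.
have [j' [jj' hx' nx']] := edge_through_node k0 tri oOm Oxi nx ex z.
have [i' [c [ex' _ _]]] := opposite_edge tri jj' ex hx'.
have j'j : j' != j by rewrite eq_sym.
rewrite (bigD1 j) /=; last exact/asboolP.
rewrite (bigD1 j') /=; last by apply/andP; split=> //; exact/asboolP.
rewrite big1 ?addr0 => [|j1 /andP[/andP[_ jj1] j'j1]]; last first.
  apply: patch_out; rewrite frontier_hullE//= => -[hx1 _].
  have jj1' : j != j1 by rewrite eq_sym.
  by move: j'j1; rewrite (neighbour_unique tri jj' jj1' ex hx' hx1) eqxx.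
rewrite /T (patch_in _ fx) (patch_in _ (edge_on_frontier ex')).
by rewrite (edge_flux_opposite jj' nx nx' ex hx') addrN.
Qed.

(** The cancellation is pointwise off the corners, so the sum over the elements is moved inside the
    integrals along common lines. *)
Lemma etau_sum : \sum_(j | N j) etau k V kappa gb uh j (defect j) = 0.
Proof.
have H j : exists h : pt -> R, nodes k (V j) xi -> nice h /\
    forall x, ~ corners V x -> (edge_flux j \_ (frontier (hull (V j)))) x = h x.
  have [nx|nnx] := pselect (nodes k (V j) xi).
    by have [h h1 h2] := edge_flux_repr nx; exists h.
  by exists (fun=> 0).
have [h hP] := choice H.
have lE j : nodes k (V j) xi -> etau k V kappa gb uh j (defect j) =
    \sum_(l \in lines_of mline) \int[lebesgue_measure]_t h j (line_at l t).
  move=> nx; apply: (lint_repr (E := corners V)).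
  - exact: mesh_line_affine.
  - exact: finite_corners.
  - exact: (frontier_hull_lines k xi tri).
  - exact: (hP j nx).2.
transitivity (\sum_(j | N j)
    \sum_(l \in lines_of mline) \int[lebesgue_measure]_t h j (line_at l t)).
  by apply: eq_bigr => j /asboolP; exact: lE.
rewrite -(sum_line_integrals (P := fun j => N j) (g := h) (mesh_line_affine k V xi)); last first.
  by move=> j /asboolP nx; exact: (hP j nx).1.
rewrite fsbig1// => l [z _ [ll _]].
rewrite (_ : Rintegral _ _ _ = \int[@lebesgue_measure R]_t cst 0 t).
  by rewrite Rintegral_cst// mul0r.
apply: (finite_null_modification (N := line_at l @^-1` corners V)).
  by apply: finite_preimage (finite_corners V) => s t _ _; exact: line_at_inj.
move=> t nc; rewrite patch_setT.
transitivity (\sum_(j | N j) (edge_flux j \_ (frontier (hull (V j)))) (line_at l t)).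
  by apply: eq_bigr => j /asboolP nx; rewrite (hP j nx).2.
exact: edge_flux_sum nc.
Qed.

(** * Assembly *)

Lemma local_conservation :
  aform kappa Om uh w = lform f Om w ->
  (forall j, post_processed k V kappa f gb uh j (ut j)) ->
  lint (frontier C) (fun x => dot (flux V kappa ut x) (onormal C x)) =
  \int[leb2]_(x in C) f x.
Proof.
move=> fe pp; rewrite lint_control integral_control -sumrN.
have key j : nodes k (V j) xi -> - lint (dual_edge k (V j) xi) (dual_flux j) =
    (\int[leb2]_x F1 j x - \int[leb2]_x F2 j x) + \int[leb2]_x FA j x +
    etau k V kappa gb uh j (defect j).
  move=> nx; have [_ /(_ _ (nodal_poly_Pk k0 (nd j) nx))] := pp j.
  rewrite /= btau_nodal// -(lform_hull nx) -(aform_hull nx).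
  have -> : (fun x => Itau k (V j) (phi j) x - phi j x) = defect j.
    by apply/funext => x; rewrite Itau_nodal.
  by [].
transitivity (\sum_(j | N j) ((\int[leb2]_x F1 j x - \int[leb2]_x F2 j x) +
    \int[leb2]_x FA j x + etau k V kappa gb uh j (defect j))).
  by apply: eq_bigr => j /asboolP; exact: key.
(* The sums of [F2] and [FA] are the load and stiffness terms of the global nodal function, equal by
   the finite element equation. *)
rewrite !big_split /= etau_sum addr0 sumrN -lform_Om -aform_Om fe.
by rewrite subrK.
Qed.

End LocalConservation.

Unset Implicit Arguments.

Theorem lemma3p4 (R : realType) (k : nat) (Om : set (R * R))
    (f kappa g : R * R -> R) (kmin kmax : R)
    (J : finType) (V : J -> 'I_3 -> R * R)
    (gh uh : R * R -> R) (gb : R * R -> R * R) (ut : J -> R * R -> R) :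
  (1 <= k)%N ->
  polygonal_lipschitz_domain Om ->
  L2 Om f ->
  measurable_fun Om kappa ->
  0 < kmin ->
  (forall x, Om x -> kmin <= kappa x <= kmax) ->
  triangulation Om V ->
  interpolant k Om V g gh ->
  fe_solution k Om V kappa f gh uh ->
  (forall j, post_processed k V kappa f gb uh j (ut j)) ->
  forall xi, Zin k Om V xi ->
    let C := control_volume k V xi in
    lint (frontier C) (fun x => dot (flux V kappa ut x) (onormal C x)) =
    \int[leb2]_(x in C) f x.
Proof.
move=> k0 [[_ oOm] _ _ _ lip] fL2 mkappa kmin0 bkappa tri _ [uh_fe _ fe] pp xi [dxi nfxi] C.
have nd j : Defs.nondegenerate (V j) by have [_ + _] := tri.
have rOm := interior_closure_lipschitz oOm lip.
(* A node lies in the closure of [Om]; off the frontier it is in the interior of that closure, hence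
   in [Om]. *)
have Oxi : Om xi.
  have [j _ nx] := dxi.
  apply: rOm; apply: contrapT => nix; apply: nfxi; split.
    by apply: (hull_closure tri); exact: (nodes_hull k0 (nd j) nx).
  move=> /interior_subset Ox; apply: nix.
  by apply: filterS (@subset_closure _ Om) _; exact: open_nbhs_nbhs.
apply: (local_conservation k0 oOm rOm fL2 mkappa (K := kmax) _ tri Oxi uh_fe _ _ pp).
- move=> x /bkappa /andP[h1 h2]; rewrite ger0_norm//.
  exact: le_trans (ltW kmin0) h1.
- by move=> j; have [] := pp j.
- exact: (fe _ (nodal_fun_Vh k0 tri oOm rOm Oxi)).
Qed.
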